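(* Let $H$ be a real Hilbert space and let $B: H\to H$ be a monotone (possibly nonlinear), hemicontinuous operator defined on all of $H$. Assume that the equation $B(u)=0$ has at least one solution in $H$. Let $$\epsilon(t)=\frac{c_1}{(c_0+t)^b},\qquad t\ge 0,$$ where $c_0>0$, $c_1>0$ and $0<b<1$ are constants, and let $u_0\in H$ be arbitrary. Then the Cauchy problem $$\dot u=-B(u)-\epsilon(t)u,\qquad u(0)=u_0,$$ has a unique global solution $u(t)$ (defined for all $t\ge 0$), the strong limit $u(\infty):=\lim_{t\to\infty}u(t)$ exists in $H$, $B(u(\infty))=0$, and $u(\infty)=y$, where $y$ is the unique minimal-norm element of the set $\{z\in H: B(z)=0\}$ of all solutions of $B(u)=0$.
   Context: $(\cdot,\cdot)$ and $\|\cdot\|$ denote the inner product and norm of $H$. $B$ is monotone if $(B(u)-B(v),u-v)\ge 0$ for all $u,v\in H$. $B$ is hemicontinuous if for all $u,v,z\in H$ the function $s\mapsto (B(u+sv),z)$ is continuous on $\mathbb{R}$. For such $B$, the set $N=\{z\in H: B(z)=0\}$, if non-empty, is closed and convex, hence has a unique element of minimal norm. The dot denotes the derivative with respect to $t$. Since $B$ is only hemicontinuous, the derivative in the Cauchy problem is understood in the weak sense: a global solution is a (strongly) continuous function $u:[0,\infty)\to H$ with $u(0)=u_0$ such that for every $z\in H$ the function $t\mapsto (u(t),z)$ is differentiable with derivative $-(B(u(t))+\epsilon(t)u(t),z)$ for all $t\ge 0$ (one-sided at $t=0$). *)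

(* Defs.v *)
From HB Require Import structures.
From mathcomp Require Import all_boot all_order all_algebra.
From mathcomp Require Import all_classical all_reals all_analysis.

Set Implicit Arguments.
Unset Strict Implicit.
Unset Printing Implicit Defensive.

Import Order.TTheory GRing.Theory Num.Theory.
Import numFieldNormedType.Exports.

Local Open Scope classical_set_scope.
Local Open Scope ring_scope.

(* A real Hilbert space is a complete normed module [H] together with a
   symmetric positive definite bilinear form [ip] inducing its norm. *)
Definition norm_induced_by (R : realType) (H : completeNormedModType R)
    (ip : {dot H for idfun}) : Prop :=
  forall u : H, `|u| = Num.sqrt (ip u u).

Definition monotone_op (R : realType) (H : completeNormedModType R)
    (ip : {dot H for idfun}) (B : H -> H) : Prop :=
  forall u v : H, 0 <= ip (B u - B v) (u - v).

Definition hemicontinuous (R : realType) (H : completeNormedModType R)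
    (ip : {dot H for idfun}) (B : H -> H) : Prop :=
  forall u v z : H, continuous (fun s : R => ip (B (u + s *: v)) z).

(* Values of [u] at negative times are irrelevant: continuity is relative to
   [0, +oo[ and the derivative at 0 is one-sided. *)
Definition weak_global_solution (R : realType) (H : completeNormedModType R)
    (ip : {dot H for idfun}) (B : H -> H) (eps : R -> R) (u0 : H)
    (u : R -> H) : Prop :=
  [/\ {within `[0, +oo[, continuous u},
      u 0 = u0,
      forall (z : H) (t : R), 0 < t ->
        is_derive t 1 (fun s : R => ip (u s) z)
          (- ip (B (u t) + eps t *: u t) z)
    & forall z : H,
        h^-1 * (ip (u h) z - ip (u 0) z) @[h --> 0^'+] -->
          - ip (B (u 0) + eps 0 *: u 0) z].

Definition minimal_norm_zero (R : realType) (H : completeNormedModType R)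
    (B : H -> H) (y : H) : Prop :=
  B y = 0 /\ forall z : H, B z = 0 -> `|y| <= `|z|.

(* Main.v *)
Require Import Defs.
From HB Require Import structures.
From mathcomp Require Import all_boot all_order all_algebra.
From mathcomp Require Import all_classical all_reals all_analysis.
From mathcomp Require Import ring lra.

Set Implicit Arguments.
Unset Strict Implicit.
Unset Printing Implicit Defensive.

Import Order.TTheory GRing.Theory Num.Theory.
Import numFieldNormedType.Exports.

Local Open Scope classical_set_scope.
Local Open Scope ring_scope.

(* Existence.  A monotone hemicontinuous operator defined everywhere is locally
   bounded (by the uniform boundedness principle) and demicontinuous.  Explicit
   Euler polygons with steps [d] and [d'] stay [O(sqrt (d + d'))]-close by
   monotonicity, hence converge strongly to a local solution.  Two solutions
   contract, so [|u (t + h) - u t|] is controlled uniformly in [t] and a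
   solution on [[0, T[] extends to [T].

   Convergence.  The flow with constant weight [e] converges to a solution [V e]
   of [B (V e) + e *: V e = 0].  By monotonicity [|V e|] increases to a finite
   limit as [e] decreases to 0 and
   [|V e' - V e|^2 <= |V e|^2 - |V e'|^2] for [e < e'], so [V e] converges
   strongly, to the minimal-norm zero [y].  Finally [g t = |u t - V (eps t)|]
   satisfies [g' <= - eps g + |y| |eps'| / eps], where
   [|eps'| / eps = O (1 / t)] is negligible against [eps] since [b < 1]. *)

(** * Right-sided comparison on the real line *)

Section RealLine.
Variable R : realType.
Implicit Types (a b t s : R) (P : R -> Prop).

(** [B] carries no Lipschitz or compactness property and [u] has no strong derivative to work with;
    Euler polygons and glued solutions moreover have corners. Differential inequalities are
    therefore stated with right derivatives in the weak sense plus left continuity, and all go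
    through one barrier argument, [dini_le0]. Two-sided derivatives occur only in the passage from
    and to weak solutions. The rate [sqrt (d + d')] arises because monotonicity pairs a difference
    of velocities with the difference of the nodes where they are evaluated. Replacing it by the
    difference of the polygons costs a term linear in [d + d'] in the derivative of the squared
    distance. Minimality of [y] is carried in the variational form [|y|^2 <= (y, z)] for every zero
    [z], which makes both minimality and uniqueness one-line consequences. *)

Lemma near_right_ex t P : (\forall s \near t^'+, P s) ->
  exists2 r, 0 < r & forall s, t < s < t + r -> P s.
Proof.
move=> [r /= r0 h]; exists r => // s /andP[ts st]; apply: h => //=.
by rewrite distrC gtr0_norm ?subr_gt0 // ltrBlDl.
Qed.

Lemma ex_near_right t P r : 0 < r -> (forall s, t < s < t + r -> P s) ->
  \forall s \near t^'+, P s.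
Proof.
move=> r0 h; near=> s; apply: h; apply/andP; split; near: s.
  exact: nbhs_right_gt.
by apply: nbhs_right_lt; rewrite ltrDl.
Unshelve. all: by end_near. Qed.

Lemma near_left_ex t P : (\forall s \near t^'-, P s) ->
  exists2 r, 0 < r & forall s, t - r < s < t -> P s.
Proof.
move=> [r /= r0 h]; exists r => // s /andP[ts st]; apply: h => //=.
by rewrite gtr0_norm ?subr_gt0 // ltrBlDr -ltrBlDl.
Qed.

Lemma ex_near_left t P r : 0 < r -> (forall s, t - r < s < t -> P s) ->
  \forall s \near t^'-, P s.
Proof.
move=> r0 h; near=> s; apply: h; apply/andP; split; near: s.
  by apply: nbhs_left_gt; rewrite ltrBlDr ltrDl.
exact: nbhs_left_lt.
Unshelve. all: by end_near. Qed.

(** Let [c] be the supremum of the points up to which [P] holds throughout. The left hypothesis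
    gives [P c], and if [c < b] the right one carries [P] beyond [c]. This serves both the
    comparison below and the continuation of solutions in time. *)
Lemma real_induction P a b : a <= b -> P a ->
  (forall t, a <= t < b -> P t -> \forall s \near t^'+, P s) ->
  (forall t, a < t <= b -> (forall s, a <= s < t -> P s) -> P t) ->
  P b.
Proof.
move=> ab Pa Pr Pl.
pose S := [set t | a <= t <= b /\ forall s, a <= s <= t -> P s].
have Sa : S a.
  split; first by rewrite lexx.
  by move=> s /andP[h1 h2]; rewrite (_ : s = a) //; apply/le_anti/andP.
have hS : has_sup S.
  by split; [exists a | exists b => t [/andP[_ ?] _]].
set c := sup S.
have ac : a <= c by apply: sup_ubound => //; case: hS.
have cb : c <= b by apply: ge_sup; [exists a | move=> t [/andP[_ ?] _]].
have Pc' s : a <= s < c -> P s.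
  move=> /andP[as_ sc].
  have [e Se se] := sup_adherent (eps := c - s) (ltac:(by rewrite subr_gt0)) hS.
  case: Se => _; apply; rewrite as_ /=.
  by apply: ltW; move: se; rewrite -/c opprB addrC subrK.
have Pc : P c.
  move: ac; rewrite le_eqVlt => /predU1P[<- //|ac].
  by apply: Pl; rewrite ?ac.
have [cb'|] := ltP c b; last by move=> bc; rewrite (_ : b = c) //; apply/le_anti/andP.
have [r r0 hr] := near_right_ex (Pr c (ltac:(by rewrite ac)) Pc).
pose d := Num.min (c + r / 2) b.
have cd : c < d by rewrite /d lt_min cb' andbT ltrDl divr_gt0.
have Sd : S d.
  split; first by rewrite (le_trans ac (ltW cd)) /= /d ge_min lexx orbT.
  move=> s /andP[as_ sd]; have [sc|cs|->//] := ltgtP s c.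
    by apply: Pc'; rewrite as_.
  apply: hr; rewrite cs /=; apply: (le_lt_trans sd).
  by rewrite /d gt_min ltrD2l ltr_pdivrMr // ltr_pMr // ltr1n.
have := sup_ubound hS.2 Sd; rewrite -/c leNgt cd //.
Qed.

(** Barrier argument: [f] stays below a line of small slope [n]. The line lies above 0, so [f] is
    positive wherever it touches it, and the Dini bound is called upon only at such points. *)
Lemma dini_le0 (f : R -> R) a b : a <= b ->
  (forall t, a < t <= b -> f x @[x --> t^'-] --> f t) ->
  (forall t, a <= t < b -> f x @[x --> t^'+] --> f t) ->
  (forall t, a <= t < b -> 0 < f t -> forall n, 0 < n ->
     \forall s \near t^'+, f s <= f t + n * (s - t)) ->
  f a <= 0 -> f b <= 0.
Proof.
move=> ab fl fr fD fa; rewrite leNgt; apply/negP => fb0.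
(* The barrier is [n * (1 + t - a)]: the [1] keeps it positive at [a], even if [a = b], and its
   value at [b] is [f b / 2]. *)
pose n := f b / (2 * (1 + b - a)).
have k0 : 0 < 1 + b - a by lra.
have n0 : 0 < n by rewrite divr_gt0 // mulr_gt0.
suff : f b <= n * (1 + b - a).
  rewrite /n invfM mulrA -mulrA mulVf ?lt0r_neq0 // mulr1; lra.
apply: (@real_induction (fun t => f t <= n * (1 + t - a)) a b) => //.
- by rewrite addrK mulr1 (le_trans fa) // ltW.
- move=> t tab; have at_ : a <= t by case/andP: tab.
  rewrite le_eqVlt => /predU1P[ft|ft].
    have ft0 : 0 < f t by rewrite ft mulr_gt0 //; lra.
    apply: filterS (fD t tab ft0 n n0) => s; rewrite ft; lra.
  have /cvgr_lt /(_ _ ft) := fr t tab.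
  move=> h; near=> s; apply: (@le_trans _ _ (n * (1 + t - a))).
    by apply: ltW; near: s.
  rewrite ler_pM2l // lerD2r lerD2l; near: s; exact: nbhs_right_ge.
- move=> t tab h; have [at_ tb] := andP tab.
  rewrite leNgt; apply/negP => ft.
  have /cvgr_gt /(_ _ ft) [r /= r0 hr] := fl t tab.
  pose s := Num.max a (t - r / 2).
  have st : s < t by rewrite /s gt_max at_ /= ltrBlDr ltrDl divr_gt0.
  have as_ : a <= s by rewrite /s le_max lexx.
  have := h s; rewrite as_ st => /(_ isT).
  rewrite leNgt => /negP; apply.
  apply: (@le_lt_trans _ _ (n * (1 + t - a))).
    by rewrite ler_pM2l // lerD2r lerD2l ltW.
  apply: hr => //=; rewrite gtr0_norm ?subr_gt0 //.
  have : t - r / 2 <= s by rewrite /s le_max lexx orbT.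
  lra.
Unshelve. all: by end_near. Qed.

End RealLine.

(** * Inner product identities and the Cauchy-Schwarz inequality *)

Section InnerProduct.
Variables (R : realType) (H : completeNormedModType R) (ip : {dot H for idfun}).
Hypothesis hH : norm_induced_by ip.

Lemma ipC (u v : H) : ip u v = ip v u.
Proof. by rewrite (hermitian_subproof (s := ip)) /= expr0 mul1r. Qed.

Lemma ipDr (z u v : H) : ip z (u + v) = ip z u + ip z v.
Proof. exact: linearDr. Qed.
Lemma ipNr (z u : H) : ip z (- u) = - ip z u.
Proof. exact: linearNr. Qed.
Lemma ipZr (k : R) (z u : H) : ip z (k *: u) = k * ip z u.
Proof. exact: (linearZr_LR ip). Qed.
Lemma ipDl (z u v : H) : ip (u + v) z = ip u z + ip v z.
Proof. by rewrite ipC ipDr !(ipC z). Qed.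
Lemma ipNl (z u : H) : ip (- u) z = - ip u z.
Proof. by rewrite ipC ipNr (ipC z). Qed.
Lemma ipZl (k : R) (z u : H) : ip (k *: u) z = k * ip u z.
Proof. by rewrite ipC ipZr (ipC z). Qed.
Lemma ip0l (z : H) : ip 0 z = 0.
Proof. by rewrite -(scale0r 0) ipZl mul0r. Qed.
Lemma ip0r (z : H) : ip z 0 = 0.
Proof. by rewrite ipC ip0l. Qed.

Definition ipE := (ipDl, ipDr, ipNl, ipNr, ipZl, ipZr, ip0l, ip0r).

Lemma ip_ge0 (u : H) : 0 <= ip u u.
Proof.
have [->|u0] := eqVneq u 0; first by rewrite ip0l.
by apply: ltW; apply: neq0_dnorm_gt0.
Qed.

Lemma ip_sqr (u : H) : ip u u = `|u| ^+ 2.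
Proof. by rewrite hH sqr_sqrtr // ip_ge0. Qed.

Lemma sqrnormB (u v : H) : `|u - v| ^+ 2 = `|u| ^+ 2 - 2 * ip u v + `|v| ^+ 2.
Proof. rewrite -!ip_sqr !ipE (ipC v u); ring. Qed.

Lemma sqrnormD (u v : H) : `|u + v| ^+ 2 = `|u| ^+ 2 + 2 * ip u v + `|v| ^+ 2.
Proof. rewrite -!ip_sqr !ipE (ipC v u); ring. Qed.

Lemma cauchy_schwarz (u v : H) : `|ip u v| <= `|u| * `|v|.
Proof.
have [->|v0] := eqVneq v 0; first by rewrite ip0r !normr0 mulr0.
rewrite -ler_sqr ?nnegrE ?mulr_ge0 // real_normK ?num_real // exprMn.
have v1 : 0 < `|v| ^+ 2 by rewrite exprn_gt0 // normr_gt0.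
have := ip_ge0 (`|v| ^+ 2 *: u - ip u v *: v).
rewrite !ipE !ip_sqr (ipC v u).
rewrite (_ : _ + _ = `|v| ^+ 2 * (`|u| ^+ 2 * `|v| ^+ 2 - ip u v ^+ 2)); last by ring.
by rewrite pmulr_rge0 // subr_ge0.
Qed.

Lemma ip_le (u v : H) : ip u v <= `|u| * `|v|.
Proof. exact: le_trans (ler_norm _) (cauchy_schwarz u v). Qed.

Lemma ip_ge (u v : H) : - (`|u| * `|v|) <= ip u v.
Proof. by have := cauchy_schwarz u v; rewrite ler_norml => /andP[]. Qed.

End InnerProduct.

(** * Monotone operators and weak right derivatives *)

Section MonotoneOperator.
Variables (R : realType) (H : completeNormedModType R) (ip : {dot H for idfun}).
Hypothesis hH : norm_induced_by ip.
Variable B : H -> H.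
Hypothesis hmono : monotone_op ip B.

(* The functionals [ip (B w) / (1 + |B w| |w - u|)], for [w] in the unit ball
   around [u], are pointwise bounded by monotonicity tested at [u + z], hence
   uniformly bounded. *)
Lemma monotone_locally_bounded (u : H) : exists r M : R,
  [/\ 0 < r, 0 < M & forall w, `|w - u| <= r -> `|B w| <= M].
Proof.
pose al (w : H) := 1 + `|B w| * `|w - u|.
have al1 w : 1 <= al w by rewrite lerDl mulr_ge0.
have al0 w : 0 < al w by apply: lt_le_trans (al1 w).
pose F : set (H -> R^o) :=
  [set f | exists2 w, `|w - u| <= 1 & f = fun z => ip (B w) z / al w].
have pw1 w z : `|w - u| <= 1 ->
    ip (B w) z <= al w * (1 + `|B (u + z)| * (1 + `|z|)).
  move=> wu; have := hmono w (u + z).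
  rewrite opprD addrA (ipDr _ (B w - B (u + z))) ipNr.
  rewrite (ipDl _ z) ipNl (ipDl _ (w - u)) ipNl => h.
  have h1 := ip_le hH (B w) (w - u).
  have h2 := ip_ge hH (B (u + z)) (w - u).
  have h3 := ip_le hH (B (u + z)) z.
  have h4 : `|B (u + z)| * `|w - u| <= `|B (u + z)| * 1 by rewrite ler_wpM2l.
  have h5 : 0 <= `|B (u + z)| * (1 + `|z|) by rewrite mulr_ge0 // addr_ge0.
  have h6 : `|B (u + z)| * (1 + `|z|) <= al w * (`|B (u + z)| * (1 + `|z|)).
    by rewrite ler_peMl.
  rewrite mulrDr mulr1 /al in h6 *; lra.
have bd : forall f, F f -> bounded_fun_norm f /\ linear f.
  move=> _ [w _ ->]; split; last first.
    by move=> k x y; rewrite !ipE mulrDl -mulrA.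
  move=> r; exists (`|B w| * r / al w) => x xr.
  rewrite normrM normfV (gtr0_norm (al0 w)) ler_pM2r ?invr_gt0 //.
  apply: (le_trans (cauchy_schwarz hH _ _)); exact: ler_wpM2l.
have pb : pointwise_bounded F.
  move=> z.
  exists (1 + `|B (u + z)| * (1 + `|z|) + `|B (u - z)| * (1 + `|z|)).
  move=> _ [w wu ->].
  rewrite normrM normfV (gtr0_norm (al0 w)) ler_pdivrMr // mulrC.
  have h5 v : 0 <= al w * (`|B v| * (1 + `|z|)).
    by rewrite mulr_ge0 ?(ltW (al0 w)) // mulr_ge0 // addr_ge0.
  have h1 := pw1 w z wu; have := pw1 w (- z) wu; rewrite ipNr normrN => h2.
  have h3 := h5 (u + z); have h4 := h5 (u - z).
  rewrite ler_norml; apply/andP; split; rewrite !mulrDr in h1 h2 h3 h4 *; lra.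
have [K hK] := Banach_Steinhauss bd pb 1.
pose K' := Num.max K 1.
have K'1 : 1 <= K' by rewrite /K' le_max lexx orbT.
have hB w : `|w - u| <= 1 -> `|B w| <= K' * al w.
  move=> wu; have [->|Bw0] := eqVneq (B w) 0.
    by rewrite normr0 mulr_ge0 // ?(ltW (al0 w)) // (le_trans ler01).
  have := hK _ (ex_intro2 _ _ w wu erefl) (`|B w|^-1 *: B w).
  have n0 : `|B w| != 0 by rewrite normr_eq0.
  rewrite normrZ normfV normr_id mulVf // lexx => /(_ isT).
  rewrite ipZr (ip_sqr hH) expr2 mulKf // normrM normfV normr_id.
  rewrite (gtr0_norm (al0 w)) ler_pdivrMr // => /le_trans; apply.
  by rewrite ler_pM2r // /K' le_max lexx.
have K'0 : 0 < K' by apply: lt_le_trans K'1.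
exists (2 * K')^-1, (2 * K'); split; rewrite ?invr_gt0 ?mulr_gt0 // => w wu.
have wu1 : `|w - u| <= 1 by apply: (le_trans wu); rewrite invf_le1; lra.
have := hB w wu1; rewrite /al.
have : K' * (`|B w| * `|w - u|) <= K' * (`|B w| * (2 * K')^-1).
  by rewrite ler_pM2l // ler_wpM2l.
rewrite (_ : K' * (_ / _) = `|B w| / 2); last by field; rewrite lt0r_neq0.
rewrite mulrDr mulr1; lra.
Qed.

Hypothesis hhemi : hemicontinuous ip B.

(** Minty's trick: monotonicity between [w] and [u + s *: z] bounds [s (B w - B (u + s z), z)] by
    [(B w - B (u + s z), w - u)]. Hemicontinuity fixes [s] first; then the local bound on [B w]
    makes the right side small as [w] tends to [u]. The opposite inequality is the same one for
    [- z]. *)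
Lemma demicontinuous_sub (u z : H) (e : R) : 0 < e -> exists2 r, 0 < r &
  forall w, `|w - u| < r -> ip (B w) z <= ip (B u) z + e.
Proof.
move=> e0; have [r [M [r0 M0 hM]]] := monotone_locally_bounded u.
have : \forall s \near (0 : R)^'+, ip (B (u + s *: z)) z < ip (B u) z + e / 2.
  have h := hhemi (u := u) (v := z) (z := z) (x := 0).
  move: h; rewrite /continuous_at scale0r addr0 => /cvg_at_right_filter /cvgr_lt.
  by apply; rewrite ltrDl divr_gt0.
move=> /near_right_ex [d d0 hd].
pose s := d / 2; have s0 : 0 < s by rewrite divr_gt0.
have hs : ip (B (u + s *: z)) z < ip (B u) z + e / 2.
  by apply: hd; rewrite s0 add0r /s; lra.
pose C := M + `|B (u + s *: z)|.
have C0 : 0 < C by rewrite ltr_pwDl.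
(* Within this radius [C |w - u| < s e / 2], so division by [s] leaves an error [e / 2]; the other
   half was spent on hemicontinuity. *)
exists (Num.min r (s * (e / 2) / C)).
  by rewrite lt_min r0 divr_gt0 // mulr_gt0 // divr_gt0.
move=> w; rewrite lt_min => /andP[/ltW wr wC].
have := hmono w (u + s *: z).
rewrite opprD addrA (ipDr _ (B w - _)) ipNr ipZr (ipDl _ z) ipNl => h1.
have h2 := ip_le hH (B w - B (u + s *: z)) (w - u).
have h3 : `|B w - B (u + s *: z)| * `|w - u| <= C * `|w - u|.
  rewrite ler_wpM2r // (le_trans (ler_normB _ _)) // lerD2r; exact: hM.
have h4 : C * `|w - u| < s * (e / 2) by rewrite mulrC -ltr_pdivlMr.
have h5 : s * (ip (B w) z - ip (B (u + s *: z)) z) <= s * (e / 2) by lra.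
rewrite ler_pM2l // in h5; lra.
Qed.

Lemma demicontinuous (u z : H) (e : R) : 0 < e -> exists2 r, 0 < r &
  forall w, `|w - u| < r -> `|ip (B w - B u) z| <= e.
Proof.
move=> e0; have [r r0 hr] := demicontinuous_sub u z e0.
have [r' r'0 hr'] := demicontinuous_sub u (- z) e0.
exists (Num.min r r'); first by rewrite lt_min r0.
move=> w; rewrite lt_min => /andP[/hr h1 /hr'].
rewrite !ipNr ipDl ipNl ler_norml => h2; lra.
Qed.

End MonotoneOperator.

(** * Calculus of weak right derivatives *)

Section RightDerivative.
Variables (R : realType) (H : completeNormedModType R) (ip : {dot H for idfun}).
Hypothesis hH : norm_induced_by ip.
Implicit Types (p q : R -> H) (t a b : R).

(* A weak right derivative, with the strong Lipschitz bound that makes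
   [|p|^2] right differentiable. *)
Definition rderiv p t (q : H) : Prop :=
  (forall (z : H) (e : R), 0 < e -> \forall s \near t^'+,
     `|ip (p s - p t) z - (s - t) * ip q z| <= e * (s - t)) /\
  (exists K : R, \forall s \near t^'+, `|p s - p t| <= K * (s - t)).

Lemma rderiv_lin p t (q : H) :
  (\forall s \near t^'+, p s = p t + (s - t) *: q) -> rderiv p t q.
Proof.
move=> h; split=> [z e e0|]; [|exists `|q|].
  near=> s; have -> : p s = p t + (s - t) *: q by near: s.
  rewrite (addrC (p t)) addrK ipZl subrr normr0 mulr_ge0 ?(ltW e0) // subr_ge0.
  by near: s; exact: nbhs_right_ge.
near=> s; have -> : p s = p t + (s - t) *: q by near: s.
rewrite (addrC (p t)) addrK normrZ mulrC ger0_norm // subr_ge0.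
by near: s; exact: nbhs_right_ge.
Unshelve. all: by end_near. Qed.

Lemma rderiv_cst (v : H) t : rderiv (fun=> v) t 0.
Proof. by apply: rderiv_lin; apply: nearW => s; rewrite scaler0 addr0. Qed.

Lemma rderivB p p' t (q q' : H) : rderiv p t q -> rderiv p' t q' ->
  rderiv (fun s => p s - p' s) t (q - q').
Proof.
move=> [hp [K hK]] [hp' [K' hK']]; split=> [z e e0|].
  have e2 : 0 < e / 2 by rewrite divr_gt0.
  near=> s; have h1 : `|ip (p s - p t) z - (s - t) * ip q z| <= e / 2 * (s - t).
    by near: s; exact: hp.
  have h2 : `|ip (p' s - p' t) z - (s - t) * ip q' z| <= e / 2 * (s - t).
    by near: s; exact: hp'.
  move: h1 h2; rewrite !ipE !ler_norml => /andP[h1 h2] /andP[h3 h4].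
  rewrite !mulrDr !mulrN in h1 h2 h3 h4 *.
  apply/andP; split; lra.
exists (K + K'); near=> s.
rewrite (_ : _ - _ = (p s - p t) - (p' s - p' t)); last by rewrite !opprD addrACA.
rewrite mulrDl (le_trans (ler_normB _ _)) // lerD //; near: s => //.
Unshelve. all: by end_near. Qed.

Lemma rderiv_right_continuous p t (q : H) :
  rderiv p t q -> p x @[x --> t^'+] --> p t.
Proof.
move=> [_ [K hK]]; apply/cvgrPdist_le => e e0.
pose K' := Num.max K 1.
have K'0 : 0 < K' by rewrite lt_max ltr01 orbT.
near=> s; rewrite distrC.
have ts : t <= s by near: s; exact: nbhs_right_ge.
apply: (@le_trans _ _ (K * (s - t))); first by near: s.
apply: (@le_trans _ _ (K' * (s - t))).
  by rewrite ler_wpM2r ?subr_ge0 // le_max lexx.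
rewrite mulrC -ler_pdivlMr // ltW //.
by near: s; apply: nbhs_right_ltDr; rewrite divr_gt0.
Unshelve. all: by end_near. Qed.

Lemma near_right_shift t h (P : R -> Prop) :
  (\forall s \near (t + h)^'+, P s) -> \forall s \near t^'+, P (s + h).
Proof.
move=> /near_right_ex [r r0 hr]; apply: (ex_near_right r0) => s /andP[h1 h2].
by apply: hr; rewrite ltrD2r h1 addrAC ltrD2r.
Qed.

Lemma left_continuous_shift p t h :
  p x @[x --> (t + h)^'-] --> p (t + h) ->
  p (x + h) @[x --> t^'-] --> p (t + h).
Proof.
move=> hp; apply/cvgrPdist_le => e e0.
have /cvgrPdist_le /(_ _ e0) /near_left_ex [r r0 hr] := hp.
apply: (ex_near_left r0) => s /andP[h1 h2].
by apply: hr; rewrite ltrD2r h2 addrAC ltrD2r h1.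
Qed.

Lemma rderiv_shift p t h (q : H) :
  rderiv p (t + h) q -> rderiv (fun s => p (s + h)) t q.
Proof.
have E s : s + h - (t + h) = s - t by ring.
move=> [hp [K hK]]; split=> [z e e0|]; [|exists K].
  by have := near_right_shift (hp z e e0); apply: filterS => s; rewrite E.
by have := near_right_shift hK; apply: filterS => s; rewrite E.
Qed.

Lemma rderiv_eq p p' t (q : H) :
  p t = p' t -> (\forall s \near t^'+, p s = p' s) ->
  rderiv p t q -> rderiv p' t q.
Proof.
move=> pt ps [hp [K hK]]; split=> [z e e0|]; [|exists K].
  by apply: filterS2 ps (hp z e e0) => s ->; rewrite pt.
by apply: filterS2 ps hK => s ->; rewrite pt.
Qed.

(** Expand [|p s|^2] around [p t]: the cross term is the weak derivative tested at [z = p t], and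
    [|p s - p t|^2] is of second order by the Lipschitz bound. *)
Lemma rderiv_sqrnorm p t (q : H) : rderiv p t q -> forall e, 0 < e ->
  \forall s \near t^'+,
    `|p s| ^+ 2 <= `|p t| ^+ 2 + (2 * ip q (p t) + e) * (s - t).
Proof.
move=> [hp [K hK]] e e0.
have e4 : 0 < e / 4 by rewrite divr_gt0.
pose K' := K ^+ 2 + 1.
have K'0 : 0 < K' by rewrite ltr_wpDl ?sqr_ge0.
near=> s.
have ts : 0 <= s - t by rewrite subr_ge0; near: s; exact: nbhs_right_ge.
have h1 : `|ip (p s - p t) (p t) - (s - t) * ip q (p t)| <= e / 4 * (s - t).
  by near: s; exact: hp.
have h2 : `|p s - p t| <= K * (s - t) by near: s.
have h3 : `|p s - p t| ^+ 2 <= K ^+ 2 * (s - t) * (s - t).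
  rewrite -mulrA -expr2 -exprMn ler_sqr ?nnegrE //.
  exact: le_trans h2.
have h4 : s - t < e / 4 / K' by near: s; apply: nbhs_right_ltDr; rewrite divr_gt0.
have h5 : K ^+ 2 * (s - t) * (s - t) <= e / 4 * (s - t).
  rewrite ler_wpM2r //; rewrite ltr_pdivlMr // in h4.
  apply: le_trans (ltW h4); rewrite mulrC ler_wpM2l // /K'; lra.
have := sqrnormD hH (p s - p t) (p t); rewrite subrK => ->.
move: h1; rewrite ler_norml => /andP[_ h1]; nra.
Unshelve. all: by end_near. Qed.

Lemma cvg_left_sqrnorm p t : p x @[x --> t^'-] --> p t ->
  `|p x| ^+ 2 @[x --> t^'-] --> `|p t| ^+ 2.
Proof. by move=> h; rewrite !expr2; apply: cvgM; exact: cvg_norm. Qed.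

Lemma cvg_ipl p (z : H) (F : set_system R) (l : H) : Filter F ->
  p x @[x --> F] --> l -> ip (p x) z @[x --> F] --> ip l z.
Proof.
move=> FF hp; apply/cvgrPdist_le => e e0.
have z0 : 0 < `|z| + 1 by rewrite ltr_wpDl.
have /cvgrPdist_le /(_ (e / (`|z| + 1))) := hp.
rewrite divr_gt0 // => /(_ isT); apply: filterS => x hx.
rewrite -ipNl -ipDl (le_trans (cauchy_schwarz hH _ _)) //.
rewrite ler_pdivlMr // in hx; apply: le_trans hx.
by rewrite ler_wpM2l // lerDl.
Qed.

Section Comparison.
Variables (p q : R -> H) (a b : R).
Hypothesis ab : a <= b.
Hypothesis pq : forall t, a <= t < b -> rderiv p t (q t).
Hypothesis pl : forall t, a < t <= b -> p x @[x --> t^'-] --> p t.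

(** [dini_le0] for the excess of [|p t|^2] over the line [D + C (t - a)]. Points on or below the
    line need no check, which is what yields invariant balls in [rsol_bound]. *)
Lemma sqrnorm_le (C D : R) : `|p a| ^+ 2 <= D ->
  (forall t, a <= t < b -> D + C * (t - a) < `|p t| ^+ 2 ->
     2 * ip (q t) (p t) <= C) ->
  `|p b| ^+ 2 <= D + C * (b - a).
Proof.
move=> pa hC; rewrite -subr_le0.
apply: (@dini_le0 R (fun t => `|p t| ^+ 2 - (D + C * (t - a))) a b ab).
- move=> t /pl /cvg_left_sqrnorm h; apply: cvgB => //.
  apply: cvgD; first exact: cvg_cst.
  apply: cvgM; first exact: cvg_cst.
  apply: cvgB; last exact: cvg_cst.
  exact: cvg_at_left_filter.
- move=> t /pq /rderiv_right_continuous h; apply: cvgB.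
    by rewrite !expr2; apply: cvgM; exact: cvg_norm.
  apply: cvgD; first exact: cvg_cst.
  apply: cvgM; first exact: cvg_cst.
  apply: cvgB; last exact: cvg_cst.
  exact: cvg_at_right_filter.
- move=> t tab; rewrite subr_gt0 => /(hC t tab) h e e0.
  near=> s; have st : t <= s by near: s; exact: nbhs_right_ge.
  have : `|p s| ^+ 2 <= `|p t| ^+ 2 + (2 * ip (q t) (p t) + e) * (s - t).
    by near: s; exact: rderiv_sqrnorm (pq tab) _ e0.
  have : 2 * ip (q t) (p t) * (s - t) <= C * (s - t).
    by rewrite ler_wpM2r // subr_ge0.
  rewrite mulrDl => h1 h2; lra.
- by rewrite subrr mulr0 addr0 subr_le0.
Unshelve. all: by end_near. Qed.

(** Mean value inequality for weak right derivatives; applied to [z] and [- z] it bounds an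
    increment from both sides. *)
Lemma ip_increment_le (z : H) (C : R) :
  (forall t, a <= t < b -> ip (q t) z <= C) -> ip (p b - p a) z <= C * (b - a).
Proof.
move=> hC; rewrite -subr_le0.
apply: (@dini_le0 R (fun t => ip (p t - p a) z - C * (t - a)) a b ab).
- move=> t /pl h; apply: cvgB.
    by apply: cvg_ipl; apply: cvgB => //; exact: cvg_cst.
  apply: cvgM; first exact: cvg_cst.
  apply: cvgB; last exact: cvg_cst.
  exact: cvg_at_left_filter.
- move=> t /pq /rderiv_right_continuous h; apply: cvgB.
    by apply: cvg_ipl; apply: cvgB => //; exact: cvg_cst.
  apply: cvgM; first exact: cvg_cst.
  apply: cvgB; last exact: cvg_cst.
  exact: cvg_at_right_filter.
- move=> t tab _ e e0; have h := hC t tab.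
  near=> s; have st : t <= s by near: s; exact: nbhs_right_ge.
  have : `|ip (p s - p t) z - (s - t) * ip (q t) z| <= e * (s - t).
    by near: s; exact: (pq tab).1.
  have : ip (q t) z * (s - t) <= C * (s - t).
    by rewrite ler_wpM2r // subr_ge0.
  rewrite ler_norml !ipE => h1 /andP[_ h2]; lra.
- by rewrite !subrr ip0l mulr0 subrr.
Unshelve. all: by end_near. Qed.

End Comparison.

End RightDerivative.

(** * Local solutions of the regularized equation *)

Section CauchyLimits.
Variables (R : realType) (H : completeNormedModType R).

Lemma cauchy_lim (T : Type) (F : set_system T) (FF : ProperFilter F) (f : T -> H) :
  (forall e : R, 0 < e -> exists x, \forall y \near F, `|f x - f y| <= e) ->
  exists l : H, f @ F --> l.
Proof.
move=> h; exists (lim (f @ F)); apply/cauchy_cvgP/cauchy_exP => e e0.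
have e2 : 0 < e / 2 by rewrite divr_gt0.
have [x hx] := h _ e2; exists (f x); apply: filterS hx => y hy /=.
rewrite -ball_normE /=; apply: (le_lt_trans hy).
by rewrite ltr_pdivrMr // ltr_pMr // ltr1n.
Qed.

End CauchyLimits.

Section Regularized.
Variables (R : realType) (H : completeNormedModType R) (ip : {dot H for idfun}).
Hypothesis hH : norm_induced_by ip.
Variable B : H -> H.
Hypothesis hmono : monotone_op ip B.
Hypothesis hhemi : hemicontinuous ip B.
Variables (eps : R -> R) (L : R).
Hypothesis eps_ge0 : forall t, 0 <= t -> 0 <= eps t.
Hypothesis eps_lip : forall s t, 0 <= s -> s <= t -> 0 <= eps s - eps t <= L * (t - s).

Definition regop (t : R) (u : H) : H := B u + eps t *: u.
Local Notation A := regop.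

Lemma eps_dist s t : 0 <= s -> 0 <= t -> `|eps s - eps t| <= L * `|s - t|.
Proof.
move=> s0 t0; have [st|ts] := leP s t.
  have /andP[h1 h2] := eps_lip s0 st.
  by rewrite (ger0_norm h1) distrC ger0_norm ?subr_ge0.
have /andP[h1 h2] := eps_lip t0 (ltW ts).
by rewrite distrC (ger0_norm h1) ger0_norm ?subr_ge0 // ltW.
Qed.

Lemma eps_le0 t : 0 <= t -> eps t <= eps 0.
Proof. by move=> t0; have /andP[] := eps_lip (lexx 0) t0; rewrite subr_ge0. Qed.

Lemma L_ge0 : 0 <= L.
Proof.
have /andP[h1 h2] := eps_lip (lexx 0) ler01.
by move: (le_trans h1 h2); rewrite subr0 mulr1.
Qed.

Lemma regop_locally_bounded (u : H) : exists r M : R,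
  [/\ 0 < r, 0 < M & forall s w, 0 <= s -> `|w - u| <= r -> `|A s w| <= M].
Proof.
have [r [M [r0 M0 hM]]] := monotone_locally_bounded hH hmono u.
have E0 := eps_ge0 (lexx 0).
exists r, (M + eps 0 * (`|u| + r)); split=> //.
  by rewrite ltr_pwDl // mulr_ge0 // addr_ge0 // ltW.
move=> s w s0 wu; rewrite (le_trans (ler_normD _ _)) // lerD //; first exact: hM.
rewrite normrZ (ger0_norm (eps_ge0 s0)) ler_pM ?eps_ge0 ?eps_le0 //.
by rewrite -lerBlDl (le_trans _ wu) // lerB_dist.
Qed.

Lemma regop_demicontinuous (t : R) (u z : H) (e : R) : 0 <= t -> 0 < e ->
  exists2 r, 0 < r & forall s w, 0 <= s -> `|s - t| < r -> `|w - u| < r ->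
    `|ip (A s w - A t u) z| <= e.
Proof.
move=> t0 e0; have e3 : 0 < e / 3 by rewrite divr_gt0.
have [r r0 hr] := demicontinuous hH hmono hhemi u z e3.
have E0 := eps_ge0 (lexx 0); have L0 := L_ge0.
(* Up to the summand 1, which makes it positive, [K] is the factor with which the two weight terms
   enter the pairing with [z]; together they contribute at most [e / 3]. *)
pose K := (eps 0 + L * `|u|) * `|z| + 1.
have K0 : 0 < K by rewrite ltr_wpDl // mulr_ge0 // addr_ge0 // mulr_ge0.
exists (Num.min r (e / 3 / K)).
  by rewrite lt_min r0 divr_gt0.
move=> s w s0; rewrite !lt_min => /andP[_ st] /andP[/hr wr wu].
rewrite (_ : A s w - A t u = (B w - B u) + (eps s *: (w - u) + (eps s - eps t) *: u));
  last first.
  by rewrite scalerBr scalerBl subrKA opprD addrACA.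
rewrite ipDl (le_trans (ler_normD _ _)) //.
rewrite (_ : e = e / 3 + 2 * (e / 3)); last by field.
apply: lerD => //; apply: (le_trans (cauchy_schwarz hH _ _)).
have h1 : `|eps s *: (w - u) + (eps s - eps t) *: u| <=
    (eps 0 + L * `|u|) * (e / 3 / K).
  rewrite (le_trans (ler_normD _ _)) // mulrDl !normrZ lerD //.
    by rewrite (ger0_norm (eps_ge0 s0)) ler_pM ?eps_ge0 ?eps_le0 // ltW.
  rewrite mulrAC ler_wpM2r // (le_trans (eps_dist s0 t0)) // ler_wpM2l // ltW //.
apply: (@le_trans _ _ ((eps 0 + L * `|u|) * (e / 3 / K) * `|z|)).
  by rewrite ler_wpM2r.
have gK : e / 3 / K * K = e / 3 by rewrite divfK ?lt0r_neq0.
have : 0 < e / 3 / K by rewrite divr_gt0.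
move: gK; rewrite /K; set g := e / 3 / _ => gK g0.
rewrite mulrDr mulr1 in gK; rewrite mulrAC mulrC; lra.
Qed.

(** Write [eps s w - eps t v = eps s (w - v) + (eps s - eps t) v]; the second part is the price of
    distinct times. Distinct times occur between nodes of two Euler polygons and between a solution
    and its time shift. *)
Lemma regop_monotone s t (w v : H) : 0 <= s -> 0 <= t ->
  eps s * `|w - v| ^+ 2 - L * `|s - t| * `|v| * `|w - v| <=
  ip (A s w - A t v) (w - v).
Proof.
move=> s0 t0.
rewrite (_ : A s w - A t v = (B w - B v) + (eps s *: (w - v) + (eps s - eps t) *: v));
  last first.
  by rewrite scalerBr scalerBl subrKA opprD addrACA.
rewrite !(ipDl _ (w - v)) !(ipZl _ _ (w - v)) (ip_sqr hH).
have h1 := hmono w v.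
have h2 : - (L * `|s - t| * `|v| * `|w - v|) <= (eps s - eps t) * ip v (w - v).
  suff : `|(eps s - eps t) * ip v (w - v)| <= L * `|s - t| * `|v| * `|w - v|.
    by rewrite ler_norml => /andP[].
  rewrite normrM -[leRHS]mulrA ler_pM ?eps_dist //; exact: cauchy_schwarz.
move: h1; rewrite ipDl ipNl => h1; lra.
Qed.

(** Right continuity is already part of [rderiv]. With the derivative taken only to the right, two
    solutions meeting at a point glue without any matching condition. *)
Definition rsol (u : R -> H) (a b : R) : Prop :=
  (forall t, a <= t < b -> rderiv ip u t (- A t (u t))) /\
  (forall t, a < t <= b -> u x @[x --> t^'-] --> u t).

(** * Euler polygons and their limit *)

Section LocalExistence.
Variables (a : R) (x0 : H) (r M : R).
Hypothesis a0 : 0 <= a.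
Hypothesis r0 : 0 < r.
Hypothesis M0 : 0 < M.
Hypothesis hM : forall s w, 0 <= s -> `|w - x0| <= r -> `|A s w| <= M.

(* [v] moves with velocity [- A (S t) (W t)], where [(S t, W t)] is
   [d]-close to [(t, v t)]. *)
Definition polygon (d b : R) (v : R -> H) (S : R -> R) (W : R -> H) : Prop :=
  [/\ v a = x0,
      forall s t, a <= s <= b -> a <= t <= b -> `|v t - v s| <= M * `|t - s| &
      forall t, a <= t < b ->
        [/\ 0 <= S t /\ `|S t - t| <= d, `|W t - v t| <= M * d, `|W t - x0| <= r &
            \forall s \near t^'+, v s = v t + (s - t) *: (- A (S t) (W t))]].

(** One Euler step with constant velocity [- A c (v c)]. The speed bound [M] and the elapsed time
    [c - a <= r / M] keep the node [v c] in the ball where [|A| <= M], so the new piece obeys the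
    same speed bound. *)
Lemma polygon_step d c v S W : 0 < d -> a <= c -> c - a <= r / M ->
  polygon d c v S W ->
  exists v' S' W', polygon d (c + d) v' S' W'.
Proof.
move=> d0 ac ca [va vl vS].
pose v' t := if t <= c then v t else v c + (t - c) *: (- A c (v c)).
pose S' t := if t < c then S t else c.
pose W' t := if t < c then W t else v c.
have c0 : 0 <= c by apply: le_trans ac.
have vcx : `|v c - x0| <= r.
  rewrite -va (le_trans (vl _ _ _ _)) ?lexx ?ac //.
  by rewrite ger0_norm ?subr_ge0 // mulrC -ler_pdivlMr.
have Ac : `|A c (v c)| <= M by apply: hM.
have v'c t : c <= t -> v' t = v c + (t - c) *: (- A c (v c)).
  rewrite /v' le_eqVlt => /predU1P[<-|ct]; last by rewrite leNgt ct.
  by rewrite lexx subrr scale0r addr0.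
have v'l s t : c <= s -> s <= t -> `|v' t - v' s| <= M * (t - s).
  move=> cs st; rewrite !v'c ?(le_trans cs) //; move: Ac; rewrite -normrN.
  move: (- A c (v c)) => X AX; rewrite opprD addrACA subrr add0r.
  rewrite -scalerBl opprB addrA subrK normrZ.
  by rewrite ger0_norm ?subr_ge0 // mulrC ler_wpM2r ?subr_ge0.
have v'l2 s t : a <= s -> s <= t -> `|v' t - v' s| <= M * (t - s).
  move=> as_ st; have [cs|sc] := leP c s; first exact: v'l.
  have v's : v' s = v s by rewrite /v' ltW.
  have v'c' : v' c = v c by rewrite /v' lexx.
  have [tc|ct] := leP t c.
    rewrite /v' tc (le_trans st tc) (le_trans (vl _ _ _ _)) //.
    - by rewrite as_ ltW.
    - by rewrite (le_trans as_).
    - by rewrite ger0_norm ?subr_ge0.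
  rewrite -(subrKA (v' c)) (le_trans (ler_normD _ _)) //.
  rewrite (_ : t - s = (t - c) + (c - s)); last by rewrite subrKA.
  rewrite mulrDr; apply: lerD; first by apply: v'l => //; exact: ltW.
  rewrite v's v'c' (le_trans (vl _ _ _ _)) //.
  - by rewrite as_ ltW.
  - by rewrite ac lexx.
  - by rewrite ger0_norm // subr_ge0 ltW.
exists v', S', W'; split.
- by rewrite /v' ac.
- move=> s t /andP[as_ sb] /andP[at_ tb]; have [st|ts] := leP s t.
    by rewrite [`|t - s|]ger0_norm ?subr_ge0 // v'l2.
  by rewrite distrC [`|t - s|]distrC [`|s - t|]ger0_norm ?subr_ge0 ?v'l2 // ltW.
- move=> t /andP[at_ tb]; have [tc|ct] := ltP t c.
    have tac : a <= t < c by rewrite at_ tc.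
    have [h1 h2 h3 h4] := vS t tac.
    rewrite /S' /W' tc; split=> //; first by rewrite /v' (ltW tc).
    rewrite /v' (ltW tc); near=> s.
    have -> : s <= c by near: s; exact: nbhs_right_le.
    by near: s.
  rewrite /S' /W' ltNge ct /=; split=> //.
  - rewrite distrC ger0_norm ?subr_ge0 //; split=> //; lra.
  - rewrite distrC (_ : v c = v' c); last by rewrite /v' lexx.
    by rewrite (le_trans (v'l _ _ _ _)) // ler_pM2l //; lra.
  - near=> s; have ts : t <= s by near: s; exact: nbhs_right_ge.
    rewrite !v'c // ?(le_trans ct) // -addrA -scalerDl; congr (_ + _ *: _); ring.
Unshelve. all: by end_near. Qed.

Lemma polygon_exists d n : 0 < d -> n%:R * d <= r / M ->
  exists v S W, polygon d (a + n%:R * d) v S W.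
Proof.
move=> d0; elim: n => [|n IH] hn.
  exists (fun=> x0), (fun=> 0), (fun=> x0); split=> //.
  - by move=> s t _ _; rewrite subrr normr0 mulr_ge0 // ltW.
  - by move=> t; rewrite mul0r addr0 => /andP[/le_lt_trans h /h]; rewrite ltxx.
have hn' : n%:R * d <= r / M.
  by apply: le_trans hn; rewrite ler_pM2r // ler_nat.
have [v [S [W hv]]] := IH hn'.
rewrite -natr1 mulrDl mul1r addrA; apply: polygon_step hv => //.
  by rewrite lerDl mulr_ge0 // ltW.
by rewrite addrC addKr.
Qed.

(** In the constant, [L (|x0| + r) (2 r)] comes from the distinct node times in [regop_monotone].
    The term [2 M^2] comes from pairing the velocity difference, at most [2 M], with the deviation
    of the polygons from their nodes, at most [M (d + d')]. *)
Lemma polygon_dist d d' b v S W v' S' W' t : 0 < d -> 0 < d' ->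
  polygon d b v S W -> polygon d' b v' S' W' -> a <= t <= b ->
  `|v t - v' t| ^+ 2 <=
    2 * (L * (`|x0| + r) * (2 * r) + 2 * M ^+ 2) * (d + d') * (t - a).
Proof.
move=> d0 d'0 [va vl vS] [va' vl' vS'] /andP[at_ tb].
have L0 := L_ge0.
rewrite -[leRHS]add0r.
apply: (@sqrnorm_le _ _ ip hH (fun s => v s - v' s)
  (fun s => - A (S s) (W s) - - A (S' s) (W' s)) a t at_).
- move=> s /andP[as_ st]; have sb : a <= s < b by rewrite as_ (lt_le_trans st).
  have [_ _ _ h] := vS s sb; have [_ _ _ h'] := vS' s sb.
  by apply: rderivB; exact: rderiv_lin.
- move=> s /andP[as_ st]; have sb : s <= b by apply: le_trans tb.
  have lc w : (forall s t, a <= s <= b -> a <= t <= b -> `|w t - w s| <= M * `|t - s|) ->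
      w x @[x --> s^'-] --> (w s : H).
    move=> wl; apply/cvgrPdist_le => e e0; near=> x.
    have xs : x <= s by near: x; exact: nbhs_left_le.
    have ax : a <= x by near: x; exact: nbhs_left_ge.
    apply: (le_trans (wl _ _ _ _)); rewrite ?ax ?(ltW as_) ?sb ?(le_trans xs) //.
    rewrite ger0_norm ?subr_ge0 // mulrC -ler_pdivlMr // ltW //.
    by near: x; apply: nbhs_left_ltBl; rewrite divr_gt0.
  by apply: cvgB; apply: lc.
- by rewrite va va' subrr normr0 expr2 mulr0.
- move=> s /andP[as_ st] _; have sb : a <= s < b by rewrite as_ (lt_le_trans st).
  have [[S0 Sd] Wd Wr _] := vS s sb; have [[S'0 S'd] W'd W'r _] := vS' s sb.
  have s0 : 0 <= s by apply: le_trans as_.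
  have h1 := regop_monotone (W s) (W' s) S0 S'0.
  have AW := hM S0 Wr; have AW' := hM S'0 W'r.
  set X := A (S s) (W s) in h1 AW *; set Y := A (S' s) (W' s) in h1 AW' *.
  (* Monotonicity sees only the difference of the nodes, so it is split off here. *)
  have -> : v s - v' s = (W s - W' s) - ((W s - v s) - (W' s - v' s)).
    rewrite (_ : W s - v s - _ = (W s - W' s) - (v s - v' s)) ?subKr //.
    by rewrite !opprD addrACA.
  rewrite opprK addrC ipDr ipNr -(opprB X Y) !ipNl opprK.
  have h2 : `|S s - S' s| <= d + d'.
    rewrite -(subrKA s) (le_trans (ler_normD _ _)) // lerD //.
    by rewrite distrC.
  have h3 : `|W s - W' s| <= 2 * r.
    rewrite -(subrKA x0) (le_trans (ler_normD _ _)) //.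
    by rewrite (distrC x0) mulrDl mul1r lerD.
  have h4 : `|W' s| <= `|x0| + r.
    by rewrite -lerBlDl (le_trans _ W'r) // lerB_dist.
  have h5 : L * `|S s - S' s| * `|W' s| * `|W s - W' s| <=
            L * (d + d') * (`|x0| + r) * (2 * r).
    by rewrite !ler_pM ?mulr_ge0 // ler_wpM2l.
  have h6 : 0 <= eps (S s) * `|W s - W' s| ^+ 2.
    by rewrite mulr_ge0 ?eps_ge0 // sqr_ge0.
  have h7 : `|W s - v s - (W' s - v' s)| <= M * (d + d').
    by rewrite (le_trans (ler_normB _ _)) // mulrDr lerD.
  have h8 : `|X - Y| <= 2 * M.
    by rewrite (le_trans (ler_normB _ _)) // mulrDl mul1r lerD.
  have h9 : ip (X - Y) (W s - v s - (W' s - v' s)) <= 2 * M * (M * (d + d')).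
    by apply: (le_trans (ip_le hH _ _)); rewrite ler_pM.
  nra.
Unshelve. all: by end_near. Qed.

(** The right derivative is obtained on the polygons, before the limit: for fixed [s] near [t] all
    velocities on [[t, s]] are within [e] of [- A t (u t)] in direction [z], hence so is the mean
    increment of [v n]. Letting [n] grow transfers this to [u]. *)
Lemma euler_limit : exists u : R -> H, u a = x0 /\ rsol u a (a + r / M).
Proof.
pose tau := r / M; have tau0 : 0 < tau by rewrite divr_gt0.
(* With this step, [n.+1] steps fill the interval of length [tau] exactly, so all polygons share one
   domain. *)
pose d (n : nat) := tau / n.+1%:R.
have d0 n : 0 < d n by rewrite divr_gt0.
have dE n : n.+1%:R * d n = tau by rewrite mulrC divfK.
have ex n : exists vSW : (R -> H) * (R -> R) * (R -> H),
    polygon (d n) (a + tau) vSW.1.1 vSW.1.2 vSW.2.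
  have [|v [S [W h]]] := @polygon_exists (d n) n.+1 (d0 n); first by rewrite dE.
  by exists (v, S, W); rewrite dE in h.
have [P hP] := choice ex.
pose v n := (P n).1.1.
have d_small e : 0 < e -> \forall n \near \oo, d n <= e.
  move=> e0; near=> n; rewrite /d ler_pdivrMr // mulrC -ler_pdivrMr //.
  by apply: (@le_trans _ _ n%:R); [near: n; exact: nbhs_infty_ger | rewrite ler_nat].
have v_cauchy e : 0 < e -> exists N, forall n m t, (N <= n)%N -> (N <= m)%N ->
    a <= t <= a + tau -> `|v n t - v m t| <= e.
  move=> e0; pose C := 2 * (L * (`|x0| + r) * (2 * r) + 2 * M ^+ 2).
  have L0 := L_ge0.
  have C0 : 0 < C.
    have h1 : 0 <= L * (`|x0| + r) * (2 * r).
      by rewrite mulr_ge0 ?mulr_ge0 // ?(ltW r0) // addr_ge0 // ltW.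
    have h2 : 0 < M ^+ 2 by rewrite exprn_gt0.
    rewrite /C; lra.
  (* If both steps are at most this value, the bound [C (d n + d m) tau] is at most [e^2]. *)
  have e' : 0 < e ^+ 2 / (2 * C * tau).
    by apply: divr_gt0; [rewrite exprn_gt0 | rewrite mulr_gt0 // mulr_gt0].
  have [N _ hN] := d_small _ e'; exists N => n m t /hN /= dn /hN /= dm tab.
  rewrite -ler_sqr ?nnegrE ?(ltW e0) //.
  have := polygon_dist (d0 n) (d0 m) (hP n) (hP m) tab => /le_trans; apply.
  have tt : t - a <= tau by case/andP: tab => _; lra.
  rewrite -/C; apply: (@le_trans _ _ (C * (2 * (e ^+ 2 / (2 * C * tau))) * tau)).
    have ta : 0 <= t - a by case/andP: tab => ?; lra.
    have dd : 0 <= d n + d m by rewrite addr_ge0 // ltW.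
    apply: ler_pM => //; first by rewrite mulr_ge0 // ltW.
    rewrite ler_pM2l //; lra.
  rewrite le_eqVlt; apply/predU1P; left; field.
  by rewrite !lt0r_neq0.
have exu t : exists l : H, a <= t <= a + tau -> v n t @[n --> \oo] --> l.
  have [tab|] := boolP (a <= t <= a + tau); last by exists 0.
  have [|l hl] := @cauchy_lim _ _ _ \oo _ (fun n => v n t).
    move=> e /v_cauchy [N hN]; exists N; near=> n; apply: hN => //.
    by near: n; exact: nbhs_infty_ge.
  by exists l.
have [u hu] := choice exu.
have v_unif e : 0 < e -> \forall n \near \oo, forall t, a <= t <= a + tau ->
    `|v n t - u t| <= e.
  move=> e0; have e2 : 0 < e / 2 by rewrite divr_gt0.
  have [N hN] := v_cauchy _ e2.
  near=> n => t tab; have Nn : (N <= n)%N by near: n; exact: nbhs_infty_ge.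
  have /cvgrPdist_le /(_ _ e2) [N' _ hN'] := hu t tab.
  have h1 := hN n (maxn N N') t Nn (leq_maxl _ _) tab.
  have h2 := hN' (maxn N N') (leq_maxr _ _); rewrite /= distrC in h2.
  rewrite -(subrKA (v (maxn N N') t)) (le_trans (ler_normD _ _)) //.
  by rewrite [leRHS](splitr e) lerD.
have uL s t : a <= s -> s <= t -> t <= a + tau -> `|u t - u s| <= M * (t - s).
  move=> as_ st tb; apply/ler_addgt0Pr => e e0.
  have e2 : 0 < e / 2 by rewrite divr_gt0.
  have [N _ hN] := v_unif _ e2; have {}hN := hN N (leqnn N).
  have sab : a <= s <= a + tau by rewrite as_ (le_trans st).
  have tab : a <= t <= a + tau by rewrite (le_trans as_).
  have [_ vl _] := hP N; have h3 := vl s t sab tab.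
  rewrite [`|t - s|]ger0_norm ?subr_ge0 // in h3.
  have h1 := hN t tab; have h2 := hN s sab.
  rewrite -(subrKA (v N t)) (le_trans (ler_normD _ _)) // (distrC (u t)).
  rewrite -(subrKA (v N s) (v N t) (- u s)).
  rewrite (_ : _ + e = e / 2 + (M * (t - s) + e / 2)); last by field.
  by rewrite lerD // (le_trans (ler_normD _ _)) // lerD.
exists u; split.
  have aab : a <= a <= a + tau by rewrite lexx lerDl ltW.
  have va : (fun n => v n a) = fun=> x0 by apply/funext => n; case: (hP n).
  have := hu a aab; rewrite va => h.
  exact: (norm_cvg_unique h (cvg_cst _)).
split=> [t /andP[at_ tb]|t /andP[at_ tb]]; last first.
  apply/cvgrPdist_le => e e0; near=> s.
  have st : s <= t by near: s; exact: nbhs_left_le.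
  have as_ : a <= s by near: s; exact: nbhs_left_ge.
  apply: (le_trans (uL _ _ as_ st tb)).
  rewrite mulrC -ler_pdivlMr // ltW //.
  by near: s; apply: nbhs_left_ltBl; rewrite divr_gt0.
split=> [z e e0|]; last first.
  exists M; near=> s.
  have ts : t <= s by near: s; exact: nbhs_right_ge.
  have sb : s <= a + tau by near: s; exact: nbhs_right_le.
  exact: uL.
have t0 : 0 <= t by apply: le_trans at_.
have [rho rho0 hrho] := regop_demicontinuous (u t) z t0 e0.
(* The solution of [M g + g = rho / 2]: with [s - t], [d n] and [k1] at most [g / 2], the nodes stay
   within [rho] of [(t, u t)] in time and in space. *)
pose g := rho / 2 / (M + 1).
have M1 : 0 < M + 1 by rewrite addr_gt0.
have g0 : 0 < g by rewrite !divr_gt0.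
have Mg : 0 < M * g by rewrite mulr_gt0.
have gE : M * g + g = rho / 2 by rewrite /g; field; rewrite lt0r_neq0.
near=> s.
have ts : t <= s by near: s; exact: nbhs_right_ge.
have sb : s < a + tau by near: s; exact: nbhs_right_lt.
have sg : s - t < g / 2 by near: s; apply: nbhs_right_ltDr; rewrite divr_gt0.
apply/ler_addgt0Pr => k k0.
(* The first bound keeps [v n] in the demicontinuity ball; the second makes the error of replacing
   [u] by [v n] at each of the two endpoints at most [k / 2] against [z]. *)
pose k1 := Num.min (g / 2) (k / (2 * (`|z| + 1))).
have z1 : 0 < `|z| + 1 by rewrite ltr_wpDl.
have k10 : 0 < k1 by rewrite lt_min !divr_gt0 // mulr_gt0.
have g2 : 0 < g / 2 by rewrite divr_gt0.
have [n [hn dn]] : exists n, (forall t, a <= t <= a + tau -> `|v n t - u t| <= k1)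
    /\ d n <= g / 2.
  have [N1 _ h1] := v_unif _ k10; have [N2 _ h2] := d_small _ g2.
  exists (maxn N1 N2); split; first exact: h1 (leq_maxl _ _).
  exact: h2 (leq_maxr _ _).
have k1g : k1 <= g / 2 by rewrite ge_min lexx.
have k1z : k1 * `|z| <= k / 2.
  apply: (@le_trans _ _ (k / (2 * (`|z| + 1)) * (`|z| + 1))).
    by rewrite ler_pM ?(ltW k10) // ?ge_min ?lexx ?orbT // lerDl.
  by rewrite le_eqVlt; apply/predU1P; left; field; rewrite lt0r_neq0.
have [_ vl vS] := hP n.
pose q x := - A ((P n).1.2 x) ((P n).2 x).
have vq x : t <= x < s -> rderiv ip (v n) x (q x).
  move=> /andP[tx xs]; have xab : a <= x < a + tau.
    by rewrite (le_trans at_) // (lt_trans xs).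
  by have [_ _ _ h] := vS x xab; apply: rderiv_lin.
have vlc x : t < x <= s -> v n y @[y --> x^'-] --> v n x.
  move=> /andP[tx xs]; apply/cvgrPdist_le => e' e'0; near=> y.
  have yx : y <= x by near: y; exact: nbhs_left_le.
  have ty : t <= y by near: y; exact: nbhs_left_ge.
  have ay := le_trans at_ ty; have xb := le_trans xs (ltW sb).
  apply: (le_trans (vl _ _ _ _)); rewrite ?ay ?(le_trans yx) ?(le_trans ay) //.
  rewrite ger0_norm ?subr_ge0 // mulrC -ler_pdivlMr // ltW //.
  by near: y; apply: nbhs_left_ltBl; rewrite divr_gt0.
have qz x : t <= x < s -> `|ip (q x - - A t (u t)) z| <= e.
  move=> /andP[tx xs]; have ax := le_trans at_ tx.
  have xb := lt_trans xs sb.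
  have xab : a <= x < a + tau by rewrite ax.
  have [[S0 Sd] Wd _ _] := vS x xab.
  rewrite /q -opprD ipNl normrN; apply: hrho => //.
    rewrite -(subrKA x) (le_lt_trans (ler_normD _ _)) //.
    rewrite [`|x - t|]ger0_norm ?subr_ge0 //; lra.
  rewrite -(subrKA (v n x)) (le_lt_trans (ler_normD _ _)) //.
  rewrite -(subrKA (u x) (v n x) (- u t)).
  rewrite (le_lt_trans (lerD (lexx _) (ler_normD _ _))) //.
  have h1 := hn x (ltac:(by rewrite ax ltW)).
  have h2 := uL t x at_ tx (ltW xb).
  have h3 : M * d n <= M * (g / 2) by rewrite ler_pM2l.
  have h4 : M * (x - t) <= M * (g / 2) by rewrite ler_pM2l //; lra.
  lra.
have up : ip (v n s - v n t) z <= (ip (- A t (u t)) z + e) * (s - t).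
  apply: (ip_increment_le hH ts vq vlc) => x /qz.
  by rewrite ler_norml ipDl (ipNl _ z (- _)) => /andP[_ h]; lra.
have down : ip (v n s - v n t) (- z) <= (ip (- A t (u t)) (- z) + e) * (s - t).
  apply: (ip_increment_le hH ts vq vlc) => x /qz.
  by rewrite ler_norml ipDl (ipNl _ z (- _)) !ipNr => /andP[h _]; lra.
have h1 : `|ip (v n s - u s) z| <= k / 2.
  apply: (le_trans (cauchy_schwarz hH _ _)); apply: le_trans k1z.
  by rewrite ler_wpM2r // hn // (le_trans at_) // ltW.
have h2 : `|ip (v n t - u t) z| <= k / 2.
  apply: (le_trans (cauchy_schwarz hH _ _)); apply: le_trans k1z.
  by rewrite ler_wpM2r // hn // at_ ltW.
move: h1 h2 up down; rewrite !ipNr !(ipDl _ z) !(ipNl _ z) !ler_norml.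
move=> /andP[h1 h2] /andP[h3 h4] h5 h6; apply/andP; split; lra.
Unshelve. all: by end_near. Qed.

End LocalExistence.

Lemma local_existence (a : R) (x0 : H) : 0 <= a ->
  exists2 tau, 0 < tau & exists u : R -> H, u a = x0 /\ rsol u a (a + tau).
Proof.
move=> a0; have [r [M [r0 M0 hM]]] := regop_locally_bounded x0.
by exists (r / M); [rewrite divr_gt0 | exact: euler_limit].
Qed.

End Regularized.

(** * Global solutions *)

Section GlobalExistence.
Variables (R : realType) (H : completeNormedModType R) (ip : {dot H for idfun}).
Hypothesis hH : norm_induced_by ip.
Variable B : H -> H.
Hypothesis hmono : monotone_op ip B.
Hypothesis hhemi : hemicontinuous ip B.
Variables (eps : R -> R) (L : R).
Hypothesis eps_ge0 : forall t, 0 <= t -> 0 <= eps t.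
Hypothesis eps_lip : forall s t, 0 <= s -> s <= t -> 0 <= eps s - eps t <= L * (t - s).
Implicit Types (u v : R -> H) (a b c t T : R).

Local Notation A := (regop B eps).
Local Notation rsol := (rsol ip B eps).

Lemma rsol_sub u a b a' b' : a <= a' -> b' <= b -> rsol u a b -> rsol u a' b'.
Proof.
move=> aa bb [ud ul]; split=> t /andP[h1 h2].
  by apply: ud; rewrite (le_trans aa) // (lt_le_trans h2).
by apply: ul; rewrite (le_lt_trans aa) // (le_trans h2).
Qed.

Lemma rsol_eq u v a b : (forall t, a <= t <= b -> u t = v t) ->
  rsol u a b -> rsol v a b.
Proof.
move=> uv [ud ul]; split=> t tab; have /andP[h1 h2] := tab.
  have <- : u t = v t by apply: uv; rewrite h1 ltW.
  apply: rderiv_eq (ud t tab); first by apply: uv; rewrite h1 ltW.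
  near=> s; apply: uv; apply/andP; split.
    by rewrite (le_trans h1) //; near: s; exact: nbhs_right_ge.
  by near: s; exact: nbhs_right_le.
have <- : u t = v t by apply: uv; rewrite ltW.
apply: cvg_trans (ul t tab); apply: near_eq_cvg; near=> s; apply: uv.
apply/andP; split; first by near: s; exact: nbhs_left_ge.
by apply: le_trans h2; near: s; exact: nbhs_left_le.
Unshelve. all: by end_near. Qed.

Lemma rsol_glue u v a c b : a <= c -> c <= b -> u c = v c ->
  rsol u a c -> rsol v c b -> rsol (fun t => if t <= c then u t else v t) a b.
Proof.
move=> ac cb uvc hu hv; set w := fun t => _.
have [wud wul] : rsol w a c.
  by apply: rsol_eq hu => t /andP[_ tc]; rewrite /w tc.
have [wvd wvl] : rsol w c b.
  apply: rsol_eq hv => t /andP[]; rewrite le_eqVlt => /predU1P[<- _|ct _].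
    by rewrite /w lexx.
  by rewrite /w leNgt ct.
split=> t /andP[h1 h2].
  have [tc|ct] := ltP t c; first by apply: wud; rewrite h1.
  by apply: wvd; rewrite ct.
have [tc|ct] := leP t c; first by apply: wul; rewrite h1.
by apply: wvl; rewrite ct.
Qed.

Lemma rsol_dist u v a b : 0 <= a -> a <= b -> rsol u a b -> rsol v a b ->
  `|u b - v b| <= `|u a - v a|.
Proof.
move=> a0 ab [ud ul] [vd vl]; rewrite -ler_sqr ?nnegrE //.
rewrite -[leRHS]addr0 -(mul0r (b - a)).
apply: (@sqrnorm_le _ _ ip hH (fun t => u t - v t)
  (fun t => - A t (u t) - - A t (v t)) a b ab) => //.
- by move=> t tab; apply: rderivB; [exact: ud | exact: vd].
- by move=> t tab; apply: cvgB; [exact: ul | exact: vl].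
move=> t /andP[at_ _] _; have t0 := le_trans a0 at_.
have := regop_monotone hH hmono eps_lip (u t) (v t) t0 t0.
rewrite subrr normr0 mulr0 !mul0r subr0 -opprD ipNl => h.
have : 0 <= eps t * `|u t - v t| ^+ 2 by rewrite mulr_ge0 ?eps_ge0 // sqr_ge0.
lra.
Qed.

Lemma rsol_unique u v a b : 0 <= a -> rsol u a b -> rsol v a b -> u a = v a ->
  forall t, a <= t <= b -> u t = v t.
Proof.
move=> a0 hu hv uv t /andP[at_ tb]; apply/eqP; rewrite -subr_eq0 -normr_le0.
have := rsol_dist a0 at_ (rsol_sub (lexx a) tb hu) (rsol_sub (lexx a) tb hv).
by rewrite uv subrr normr0.
Qed.

(** The ball of radius [N >= |z|] around a zero [z] is invariant: outside it [(u, u - z) >= |u -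
    z|^2 - |z| |u - z| >= 0], so the weight term points inward, and monotonicity handles [B]. *)
Lemma rsol_bound u a b (z : H) (N : R) : 0 <= a -> a <= b -> rsol u a b ->
  B z = 0 -> `|u a - z| <= N -> `|z| <= N -> `|u b - z| <= N.
Proof.
move=> a0 ab [ud ul] Bz uN zN.
have N0 : 0 <= N by apply: le_trans zN.
rewrite -ler_sqr ?nnegrE // -[leRHS]addr0 -(mul0r (b - a)).
apply: (@sqrnorm_le _ _ ip hH (fun t => u t - z) (fun t => - A t (u t) - 0) a b ab).
- by move=> t tab; apply: rderivB; [exact: ud | exact: rderiv_cst].
- by move=> t tab; apply: cvgB; [exact: ul | exact: cvg_cst].
- by rewrite ler_sqr ?nnegrE.
move=> t /andP[at_ _]; have t0 := le_trans a0 at_.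
rewrite mul0r addr0 ltr_sqr ?nnegrE // => uN'.
have := regop_monotone hH hmono eps_lip (u t) z t0 t0.
rewrite subrr normr0 mulr0 !mul0r subr0 subr0 {2}/regop Bz add0r => h.
have e0 := eps_ge0 t0.
have zp := ip_ge hH z (u t - z).
have : eps t * (- (`|z| * `|u t - z|) + `|u t - z| ^+ 2) <=
    eps t * (ip z (u t - z) + `|u t - z| ^+ 2) by rewrite ler_wpM2l // lerD2r.
have : 0 <= eps t * (- (`|z| * `|u t - z|) + `|u t - z| ^+ 2).
  rewrite mulr_ge0 // addrC subr_ge0 expr2 ler_wpM2r //.
  exact: le_trans zN (ltW uN').
move: h; rewrite ipDl !ipNl (ipZl _ _ (_ - z)).
rewrite !mulrDr => h1 h2 h3; lra.
Qed.

(** The shifted solution solves the equation with the weight shifted by [h]. The mismatch costs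
    [L h N (2 N)], doubled by the derivative of the square. Since the initial increment is [O(h)],
    this gives a modulus of continuity uniform in [t]. *)
Lemma rsol_shift_dist u T t h (N : R) : 0 <= t -> 0 <= h -> t + h <= T ->
  rsol u 0 T -> (forall s, 0 <= s <= T -> `|u s| <= N) ->
  `|u (t + h) - u t| ^+ 2 <= `|u h - u 0| ^+ 2 + 4 * (L * h * N ^+ 2) * t.
Proof.
move=> t0 h0 thT [ud ul] uN; rewrite -[X in _ * X]subr0 -[u h]/(u h).
have -> : u h = u (0 + h) by rewrite add0r.
apply: (@sqrnorm_le _ _ ip hH (fun s => u (s + h) - u s)
  (fun s => - A (s + h) (u (s + h)) - - A s (u s)) 0 t t0) => //.
- move=> s /andP[s0 st]; apply: rderivB; last by apply: ud; rewrite s0 /=; lra.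
  by apply: rderiv_shift; apply: ud; apply/andP; split; lra.
- move=> s /andP[s0 st]; apply: cvgB; last by apply: ul; rewrite s0 /=; lra.
  by apply: left_continuous_shift; apply: ul; apply/andP; split; lra.
move=> s /andP[s0 st] _; have sh0 : 0 <= s + h by rewrite addr_ge0.
have := regop_monotone hH hmono eps_lip (u (s + h)) (u s) sh0 s0.
rewrite [s + h - s]addrAC subrr add0r (ger0_norm h0) -opprD ipNl => h1.
have L0 := L_ge0 eps_lip.
have h2 : 0 <= eps (s + h) * `|u (s + h) - u s| ^+ 2.
  by rewrite mulr_ge0 ?eps_ge0 // sqr_ge0.
have us : `|u s| <= N by apply: uN; apply/andP; split; lra.
have us' : `|u (s + h)| <= N by apply: uN; apply/andP; split; lra.
have h3 : `|u (s + h) - u s| <= 2 * N.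
  by rewrite (le_trans (ler_normB _ _)) // mulrDl mul1r lerD.
have h4 : L * h * `|u s| * `|u (s + h) - u s| <= L * h * (N * (2 * N)).
  rewrite -mulrA ler_wpM2l ?mulr_ge0 //; exact: ler_pM.
rewrite expr2; lra.
Qed.

(** By uniqueness [sol t] and [sol T] agree at [t], so the diagonal coincides with [sol T] on
    [[0, T]]. It turns a chosen family of solutions on growing intervals into a single function. *)
Lemma rsol_diag (sol : R -> R -> H) (u0 : H) T :
  (forall t, 0 <= t <= T -> sol t 0 = u0 /\ rsol (sol t) 0 t) ->
  rsol (fun t => sol t t) 0 T.
Proof.
move=> hs; have [T0|T0] := ltP T 0.
  by split=> t /andP[h1 h2]; exfalso; lra.
have [sT0 sT] : sol T 0 = u0 /\ rsol (sol T) 0 T by apply: hs; rewrite T0 lexx.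
apply: rsol_eq sT => t /andP[t0 tT].
have [st0 st] : sol t 0 = u0 /\ rsol (sol t) 0 t by apply: hs; rewrite t0.
have [_ sT] : sol T 0 = u0 /\ rsol (sol T) 0 T by apply: hs; rewrite T0 lexx.
apply: (rsol_unique (lexx 0) (rsol_sub (lexx 0) tT sT) st); first by rewrite sT0.
by rewrite t0 lexx.
Qed.

Hypothesis hsol : exists z : H, B z = 0.

Lemma rsol_extend (u0 : H) T : 0 < T ->
  (forall t, 0 <= t < T -> exists u, u 0 = u0 /\ rsol u 0 t) ->
  exists u, u 0 = u0 /\ rsol u 0 T.
Proof.
move=> T0 ex.
have /choice [sol hs] t : exists u : R -> H, 0 <= t < T -> u 0 = u0 /\ rsol u 0 t.
  have [/ex [u hu]|] := boolP (0 <= t < T); first by exists u.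
  by exists (fun=> 0).
pose u t := sol t t.
have u0E : u 0 = u0 by apply: (hs 0 _).1; rewrite lexx.
have hu t : t < T -> rsol u 0 t.
  move=> tT; apply: (@rsol_diag _ u0) => s /andP[s0 st]; apply: hs.
  by rewrite s0 (le_lt_trans st).
have [z Bz] := hsol.
pose N := Num.max `|u0 - z| `|z| + `|z|.
have uN t : 0 <= t < T -> `|u t| <= N.
  move=> /andP[t0 tT].
  rewrite -(subrK z (u t)) (le_trans (ler_normD _ _)) // lerD2r.
  by apply: (rsol_bound (lexx 0) t0 (hu t tT)); rewrite // ?u0E le_max lexx ?orbT.
have N0 : 0 <= N by rewrite addr_ge0 // le_max normr_ge0.
have [_ [K /near_right_ex [r r0 hK]]] : rderiv ip u 0 (- A 0 (u 0)).
  have T2 : T / 2 < T by lra.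
  by apply: (hu _ T2).1; rewrite lexx divr_gt0.
have [l hl] : exists l : H, u @ T^'- --> l.
  apply: cauchy_lim => e e0.
  have L0 := L_ge0 eps_lip.
  (* For [h <= r] the shift estimate reads [|u (x + h) - u x|^2 <= C h], using [(K h)^2 <= K^2 r h]
     and [x <= T]; the summand 1 makes [C] positive. *)
  pose C := K ^+ 2 * r + 4 * (L * N ^+ 2) * T + 1.
  have C0 : 0 < C.
    have h1 : 0 <= K ^+ 2 * r by rewrite mulr_ge0 ?sqr_ge0 // ltW.
    have h2 : 0 <= L * N ^+ 2 * T by rewrite !mulr_ge0 ?sqr_ge0 // ltW.
    rewrite /C; lra.
  pose d := Num.min r (e ^+ 2 / C).
  have d0 : 0 < d by rewrite lt_min r0 divr_gt0 // exprn_gt0.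
  have dr : d <= r by rewrite ge_min lexx.
  have dC : d * C <= e ^+ 2 by rewrite -ler_pdivlMr // ge_min lexx orbT.
  pose x := Num.max 0 (T - d).
  have x0 : 0 <= x by rewrite le_max lexx.
  have xT : x < T by rewrite gt_max T0 /=; lra.
  have xd : T - d <= x by rewrite le_max lexx orbT.
  exists x; near=> y.
  have xy : x < y by near: y; exact: nbhs_left_gt.
  have yT : y < T by near: y; exact: nbhs_left_lt.
  rewrite distrC -ler_sqr ?nnegrE ?(ltW e0) // (le_trans _ dC) //.
  pose h := y - x; have h0 : 0 < h by rewrite subr_gt0.
  have hd : h < d by rewrite /h; lra.
  have yE : y = x + h by rewrite /h addrC subrK.
  have xhy : x + h <= y by rewrite yE.
  rewrite yE; apply: (le_trans (rsol_shift_dist x0 (ltW h0) xhy (hu y yT) _)).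
    by move=> s /andP[s0 sy]; apply: uN; rewrite s0 (le_lt_trans sy).
  have h1 : `|u h - u 0| <= K * h.
    by have := hK h; rewrite subr0; apply; rewrite h0 add0r (lt_le_trans hd).
  have h2 : `|u h - u 0| ^+ 2 <= K ^+ 2 * (r * h).
    apply: (@le_trans _ _ ((K * h) ^+ 2)).
      by rewrite ler_sqr ?nnegrE // (le_trans _ h1).
    rewrite exprMn ler_wpM2l ?sqr_ge0 // expr2 ler_wpM2r ?(ltW h0) //.
    exact: ltW (lt_le_trans hd dr).
  have h3 : L * N ^+ 2 * h * x <= L * N ^+ 2 * h * T.
    by rewrite ler_wpM2l ?mulr_ge0 ?sqr_ge0 ?(ltW h0) // ltW.
  have h4 : h * C <= d * C by rewrite ler_wpM2r // ltW.
  apply: le_trans h4; rewrite /C; lra.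
exists (fun t => if t < T then u t else l); split; first by rewrite T0.
split=> t /andP[t0]; last first.
  rewrite le_eqVlt => /predU1P[->|tT].
    rewrite ltxx; apply: cvg_trans hl; apply: near_eq_cvg; near=> s.
    have -> // : s < T by near: s; exact: nbhs_left_lt.
  rewrite tT; have tt : 0 < t <= t by rewrite t0 lexx.
  apply: cvg_trans ((hu _ tT).2 t tt); apply: near_eq_cvg; near=> s.
  have -> // : s < T by apply: (@lt_trans _ _ t) => //; near: s; exact: nbhs_left_lt.
move=> tT; have t2 : t < (t + T) / 2 by lra.
have t2T : (t + T) / 2 < T by lra.
rewrite tT; apply: rderiv_eq ((hu _ t2T).1 t _); rewrite ?tT ?t0 //.
near=> s; have -> // : s < T by near: s; exact: nbhs_right_lt.
Unshelve. all: by end_near. Qed.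

Lemma global_existence (u0 : H) :
  exists u, u 0 = u0 /\ forall T, rsol u 0 T.
Proof.
have ex T : 0 <= T -> exists u, u 0 = u0 /\ rsol u 0 T.
  move=> T0.
  (* The induction runs over the final time: local existence opens the interval to the right,
     [rsol_extend] closes it on the left. *)
  apply: (@real_induction _ (fun t => exists u, u 0 = u0 /\ rsol u 0 t) 0 T T0).
  - exists (fun=> u0); split=> //.
    by split=> t /andP[h1 h2]; exfalso; lra.
  - move=> t /andP[t0 _] [u [uE hu]].
    have [tau tau0 [v [vE hv]]] :=
      local_existence hH hmono hhemi eps_ge0 eps_lip (u t) t0.
    apply: (ex_near_right tau0) => s /andP[ts st].
    exists (fun x => if x <= t then u x else v x); split; first by rewrite t0.
    apply: rsol_glue; rewrite ?(ltW ts) //.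
    by apply: rsol_sub hv => //; exact: ltW.
  - by move=> t /andP[t0 _] h; apply: rsol_extend.
have /choice [sol hs] t : exists u : R -> H, 0 <= t -> u 0 = u0 /\ rsol u 0 t.
  have [/ex [u hu]|] := boolP (0 <= t); first by exists u.
  by exists (fun=> 0).
exists (fun t => sol t t); split; first exact: (hs 0 (lexx 0)).1.
by move=> T; apply: (@rsol_diag _ u0) => t /andP[t0 _]; exact: hs.
Qed.

End GlobalExistence.

(** * The resolvent and the convergence of the solution *)

Section Resolvent.
Variables (R : realType) (H : completeNormedModType R) (ip : {dot H for idfun}).
Hypothesis hH : norm_induced_by ip.
Variable B : H -> H.
Hypothesis hmono : monotone_op ip B.
Hypothesis hhemi : hemicontinuous ip B.
Hypothesis hsol : exists z : H, B z = 0.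

(** * The flow with constant weight and its equilibrium *)

Section AutonomousFlow.
Variable e : R.
Hypothesis e0 : 0 < e.

Let eps_ge0 (t : R) : 0 <= t -> 0 <= (fun=> e) t.
Proof. by move=> _; exact: ltW. Qed.

Let eps_lip (s t : R) : 0 <= s -> s <= t ->
  0 <= (fun=> e) s - (fun=> e) t <= 0 * (t - s).
Proof. by rewrite subrr mul0r lexx. Qed.

Local Notation A := (regop B (fun=> e)).
Local Notation rsol := (rsol ip B (fun=> e)).

(* The distance is nonincreasing, so its square loses at least [2 e] times its
   final value per unit of time. *)
Lemma autonomous_decay (u v : R -> H) (T : R) : 0 <= T -> rsol u 0 T -> rsol v 0 T ->
  `|u T - v T| ^+ 2 * (1 + 2 * e * T) <= `|u 0 - v 0| ^+ 2.
Proof.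
move=> T0 hu hv; set m := `|u T - v T| ^+ 2.
suff : m <= `|u 0 - v 0| ^+ 2 + (- (2 * e * m)) * (T - 0) by rewrite subr0; lra.
apply: (@sqrnorm_le _ _ ip hH (fun t => u t - v t)
  (fun t => - A t (u t) - - A t (v t)) 0 T T0) => //.
- by move=> t tab; apply: rderivB; [exact: hu.1 | exact: hv.1].
- by move=> t tab; apply: cvgB; [exact: hu.2 | exact: hv.2].
move=> t /andP[t0 tT] _.
have := regop_monotone hH hmono eps_lip (u t) (v t) t0 t0.
rewrite !mul0r subr0 -opprD ipNl => h.
have : e * m <= e * `|u t - v t| ^+ 2.
  rewrite ler_pM2l // ler_sqr ?nnegrE //.
  apply: (rsol_dist hH hmono eps_ge0 eps_lip t0 (ltW tT)).
    exact: rsol_sub (lexx T) hu.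
  exact: rsol_sub (lexx T) hv.
lra.
Qed.

(** Compare the flow [w] from 0 with its own time shift by [y - x]: the decay over time [x] acts on
    [|w (y - x) - w 0| <= 2 N], which makes [w] Cauchy at infinity. Its limit is the equilibrium. *)
Lemma resolvent_exists : exists V : H, B V + e *: V = 0.
Proof.
have [w [_ hw]] := global_existence hH hmono hhemi eps_ge0 eps_lip hsol 0.
have [z Bz] := hsol.
pose N := Num.max `|w 0 - z| `|z| + `|z|.
have N0 : 0 <= N by rewrite addr_ge0 // le_max normr_ge0.
have wN t : 0 <= t -> `|w t| <= N.
  move=> t0; rewrite -(subrK z (w t)) (le_trans (ler_normD _ _)) // lerD2r.
  apply: (rsol_bound hH hmono eps_ge0 eps_lip (lexx 0) t0 (hw t)) => //.
    by rewrite le_max lexx.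
  by rewrite le_max lexx orbT.
have [l hl] : exists l : H, w @ +oo --> l.
  apply: cauchy_lim => d d0.
  (* Chosen so that [d^2 (2 e x) = (2 N)^2]. *)
  pose x := (2 * N) ^+ 2 / d ^+ 2 / (2 * e).
  have d2 : 0 < d ^+ 2 by rewrite exprn_gt0.
  have x0 : 0 <= x by rewrite !divr_ge0 ?sqr_ge0 // ?ltW // mulr_gt0.
  have xE : d ^+ 2 * (2 * e * x) = (2 * N) ^+ 2.
    by rewrite /x; field; rewrite !lt0r_neq0.
  exists x; near=> y.
  have xy : x <= y by near: y; apply: nbhs_pinfty_ge; exact: num_real.
  have hs : rsol (fun s => w (s + (y - x))) 0 x.
    split=> t /andP[t0 tx].
      apply: (rderiv_shift (p := w)); apply: (hw (y + 1)).1.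
      by apply/andP; split; lra.
    apply: left_continuous_shift; apply: (hw (y + 1)).2.
    by apply/andP; split; lra.
  have := autonomous_decay x0 hs (hw x).
  rewrite /= add0r (addrC x) subrK distrC => h.
  rewrite -ler_sqr ?nnegrE ?(ltW d0) //.
  have x1 : 0 < 1 + 2 * e * x.
    by rewrite ltr_pwDl // mulr_ge0 // mulr_ge0 // ltW.
  rewrite -(ler_pM2r x1) (le_trans h) // mulrDr mulr1 xE.
  have : `|w (y - x) - w 0| ^+ 2 <= (2 * N) ^+ 2.
    rewrite ler_sqr ?nnegrE ?mulr_ge0 //.
    rewrite (le_trans (ler_normB _ _)) // mulrDl mul1r lerD // wN //; lra.
  lra.
(* A nonzero residual [z'] at [l] would force [(w, z')] to decrease at rate at least [|z'|^2 / 2]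
   once [w] is close to [l]. *)
exists l; set z' := (X in X = 0); apply/eqP/negPn/negP => z'0.
have n0 : 0 < `|z'| by rewrite normr_gt0.
have n20 : 0 < `|z'| ^+ 2 / 2 by rewrite divr_gt0 // exprn_gt0.
have [r r0 hr] :=
  regop_demicontinuous hH hmono hhemi eps_ge0 eps_lip l z' (lexx 0) n20.
(* Staying within [|z'| / 8] of [l] allows [(w, z')] to change by at most [|z'|^2 / 4] over one unit
   of time, less than the forced decrease. *)
have d0 : 0 < Num.min (r / 2) (`|z'| / 8) by rewrite lt_min !divr_gt0.
have [S [S0 hS]] : exists S : R, 0 <= S /\ forall s, S <= s ->
    `|w s - l| < r /\ `|w s - l| <= `|z'| / 8.
  have /cvgrPdist_le /(_ _ d0) [S [_ hS]] := hl.
  exists (Num.max 0 S + 1); split; first by rewrite addr_ge0 // le_max lexx.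
  move=> s Ss; have : S < s.
    by apply: lt_le_trans Ss; rewrite ltr_pwDr // le_max lexx orbT.
  move=> /hS /=; rewrite distrC le_min => /andP[h1 h2]; split=> //; lra.
have := @ip_increment_le _ _ ip hH w (fun s => - A s (w s)) S (S + 1)
  ltac:(lra) _ _ z' (- (`|z'| ^+ 2 / 2)).
have h1 t : S <= t < S + 1 -> rderiv ip w t (- A t (w t)).
  move=> /andP[St tS]; apply: (hw (S + 1)).1.
  by rewrite tS (le_trans S0).
have h2 t : S < t <= S + 1 -> w x @[x --> t^'-] --> w t.
  move=> /andP[St tS]; apply: (hw (S + 1)).2.
  by rewrite tS (le_lt_trans S0).
move=> /(_ h1 h2) h.
have : ip (w (S + 1) - w S) z' <= - (`|z'| ^+ 2 / 2) * (S + 1 - S).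
  apply: h => t /andP[St _]; have [wr _] := hS t St.
  have t0 : 0 <= t by apply: le_trans St.
  have := hr 0 (w t) (lexx 0); rewrite subrr normr0 => /(_ r0 wr).
  rewrite (ipDl _ z') !(ipNl _ z') ler_norml (ip_sqr hH z'); lra.
have [_ a1] := hS S (lexx S).
have [_ a2] := hS (S + 1) (ltac:(lra)).
have a3 : `|w (S + 1) - w S| <= `|z'| / 4.
  rewrite -(subrKA l) (le_trans (ler_normD _ _)) // (distrC l); lra.
have a4 := ip_ge hH (w (S + 1) - w S) z'.
have a5 : `|w (S + 1) - w S| * `|z'| <= `|z'| / 4 * `|z'| by rewrite ler_wpM2r.
rewrite addrAC subrr add0r mulr1; rewrite expr2 in n20 *; lra.
Unshelve. all: by end_near. Qed.

End AutonomousFlow.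

(** Monotonicity with [B V = - e V] and [B V' = - e' V'] substituted. As [e] and [e'] have no
    prescribed sign, [e = 0] covers the comparison with a zero of [B]. *)
Lemma resolvent_dist (e e' : R) (V V' : H) :
  B V + e *: V = 0 -> B V' + e' *: V' = 0 ->
  e * `|V - V'| ^+ 2 <= (e' - e) * ip V' (V - V').
Proof.
move=> /eqP + /eqP; rewrite !addr_eq0 => /eqP BV /eqP BV'.
have := hmono V V'; rewrite BV BV' (ipDl _ (V - V')) !(ipNl _ (V - V')).
rewrite !(ipZl _ _ (V - V')) => h.
by have := ip_sqr hH (V - V'); rewrite {1}(ipDl _ (V - V')) ipNl => h2; rewrite -h2; lra.
Qed.

Lemma resolvent_zero (e : R) (V z : H) : 0 < e ->
  B V + e *: V = 0 -> B z = 0 -> `|V| ^+ 2 <= ip V z.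
Proof.
move=> e0 hV Bz; have hz : B z + 0 *: z = 0 by rewrite scale0r addr0.
have := resolvent_dist hz hV; rewrite mul0r subr0 pmulr_rge0 //.
by rewrite ipDr ipNr (ip_sqr hH) subr_ge0.
Qed.

Lemma norm_le_of_sqr_le_ip (u v : H) : `|u| ^+ 2 <= ip u v -> `|u| <= `|v|.
Proof.
move=> h; have [->|u0] := eqVneq u 0; first by rewrite normr0.
have u1 : 0 < `|u| by rewrite normr_gt0.
by rewrite -(ler_pM2l u1) -expr2 (le_trans h) // ip_le.
Qed.

(** [resolvent_dist] forces [(V', V - V') >= 0], and this is half the gap in the claimed
    inequality. *)
Lemma resolvent_norm_mono (e e' : R) (V V' : H) : 0 < e -> e < e' ->
  B V + e *: V = 0 -> B V' + e' *: V' = 0 ->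
  `|V' - V| ^+ 2 <= `|V| ^+ 2 - `|V'| ^+ 2.
Proof.
move=> e0 ee hV hV'; have h := resolvent_dist hV hV'.
have h1 : 0 <= ip V' (V - V').
  rewrite -(pmulr_rge0 _ (_ : 0 < e' - e)) ?subr_gt0 // (le_trans _ h) //.
  by rewrite mulr_ge0 ?sqr_ge0 // ltW.
move: h1; rewrite ipDr ipNr (ip_sqr hH) (sqrnormB hH V' V); lra.
Qed.

(** The last clause is the limit of [resolvent_zero] and characterizes [y] as the projection of 0
    onto the zero set. *)
Lemma resolvent_limit : exists (V : R -> H) (y : H),
  [/\ forall e, 0 < e -> B (V e) + e *: V e = 0,
      V e @[e --> 0^'+] --> y, B y = 0 &
      forall z, B z = 0 -> `|y| ^+ 2 <= ip y z].
Proof.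
have /choice [V hV] (e : R) : exists V : H, 0 < e -> B V + e *: V = 0.
  have [e0|_] := ltP 0 e; last by exists 0.
  by have [V hV] := resolvent_exists e0; exists V.
have [z0 Bz0] := hsol.
have Vz z e : B z = 0 -> 0 < e -> `|V e| <= `|z|.
  by move=> Bz e0; apply: norm_le_of_sqr_le_ip; exact: (resolvent_zero e0 (hV e e0)).
pose S := [set `|V e| ^+ 2 | e in [set e : R | 0 < e]].
have hS : has_sup S.
  split; first by exists (`|V 1| ^+ 2); exists 1 => //=.
  by exists (`|z0| ^+ 2) => _ [e /= e0 <-]; rewrite ler_sqr ?nnegrE // Vz.
have [y hy] : exists y : H, V @ 0^'+ --> y.
  apply: cauchy_lim => d d0.
  have d2 : 0 < d ^+ 2 by rewrite exprn_gt0.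
  have [_ [x /= x0 <-] hx] := sup_adherent d2 hS.
  exists x; near=> e.
  have e0 : 0 < e by near: e; exact: nbhs_right_gt.
  have ex : e < x by near: e; exact: nbhs_right_lt.
  rewrite -ler_sqr ?nnegrE ?(ltW d0) //.
  apply: (le_trans (resolvent_norm_mono e0 ex (hV e e0) (hV x x0))).
  have : `|V e| ^+ 2 <= sup S by apply: sup_ubound hS.2 _ _; exists e.
  lra.
exists V, y; split=> //.
  (* Test demicontinuity at [y] against [B y] itself: [B (V e) = - e V e] tends to 0 because [V e]
     is bounded, so [|B y|^2 <= d |B y|] for every [d]. *)
  apply/eqP; rewrite -normr_le0; apply/ler_addgt0Pr => d d0; rewrite add0r.
  have [->|By0] := eqVneq (B y) 0; first by rewrite normr0 ltW.
  have n0 : 0 < `|B y| by rewrite normr_gt0.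
  have d2 : 0 < d / 2 * `|B y| by rewrite mulr_gt0 // divr_gt0.
  have [r r0 hr] := demicontinuous hH hmono hhemi y (B y) d2.
  have z1 : 0 < `|z0| + 1 by rewrite ltr_wpDl.
  have : \forall e \near (0 : R)^'+, `|B y| <= d.
    near=> e.
    have e0 : 0 < e by near: e; exact: nbhs_right_gt.
    have e1 : e < d / 2 / (`|z0| + 1).
      by near: e; apply: nbhs_right_lt; rewrite !divr_gt0.
    have yV : `|V e - y| < r.
      rewrite distrC; near: e.
      have /cvgrPdist_lt := hy; exact.
    have := hr _ yV; move/eqP: (hV e e0); rewrite addr_eq0 => /eqP ->.
    rewrite ipDl !ipNl ipZl (ip_sqr hH) ler_norml => /andP[h _].
    have h1 := ip_ge hH (V e) (B y).
    have h2 : e * (`|V e| * `|B y|) <= d / 2 * `|B y|.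
      rewrite mulrA ler_wpM2r //; rewrite ltr_pdivlMr // in e1.
      apply: le_trans (ltW e1); rewrite ler_wpM2l ?(ltW e0) //.
      by rewrite (le_trans (Vz z0 e Bz0 e0)) // lerDl.
    have h3 : e * - (`|V e| * `|B y|) <= e * ip (V e) (B y).
      by rewrite ler_wpM2l // ltW.
    rewrite -(ler_pM2r n0) -expr2; lra.
  by case/filter_ex.
move=> z Bz.
have h1 : `|V e| ^+ 2 @[e --> 0^'+] --> `|y| ^+ 2.
  by rewrite !expr2; apply: cvgM; exact: cvg_norm.
have h2 : ip (V e) z @[e --> 0^'+] --> ip y z by apply: (cvg_ipl hH).
apply: ler_cvg_to h1 h2 _; near=> e.
have e0 : 0 < e by near: e; exact: nbhs_right_gt.
exact: resolvent_zero e0 (hV e e0) Bz.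
Unshelve. all: by end_near. Qed.

End Resolvent.

(** * Tracking of the resolvent curve by the solution *)

Section Convergence.
Variables (R : realType) (H : completeNormedModType R) (ip : {dot H for idfun}).
Hypothesis hH : norm_induced_by ip.
Variable B : H -> H.
Hypothesis hmono : monotone_op ip B.
Variables (eps : R -> R) (c L : R).
Hypothesis c0 : 0 < c.
Hypothesis eps_gt0 : forall t, 0 <= t -> 0 < eps t.
Hypothesis eps_lip : forall s t, 0 <= s -> s <= t -> 0 <= eps s - eps t <= L * (t - s).
Hypothesis eps_ratio : forall s t, 0 <= s -> s <= t ->
  eps s - eps t <= eps s * (t - s) / (c + s).
Hypothesis eps_to0 : eps t @[t --> +oo] --> 0.
Hypothesis eps_toy : forall K : R, \forall t \near +oo, K <= eps t * (c + t).
Variables (V : R -> H) (y : H).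
Hypothesis hV : forall e, 0 < e -> B (V e) + e *: V e = 0.
Hypothesis Vy : V e @[e --> 0^'+] --> y.
Hypothesis By : B y = 0.

(** Dividing [resolvent_dist] by [|V (eps s) - V (eps t)|] and using [|V (eps t)| <= |y|] leaves
    [|y| (eps s - eps t) / eps s], which [eps_ratio] bounds. *)
Let V_lip s t : 0 <= s -> s <= t ->
  `|V (eps s) - V (eps t)| <= `|y| / (c + s) * (t - s).
Proof.
move=> s0 st; have t0 := le_trans s0 st.
have es := eps_gt0 s0; have et := eps_gt0 t0.
have cs : 0 < c + s by rewrite ltr_pwDl.
have [->|VV] := eqVneq (V (eps s)) (V (eps t)).
  by rewrite subrr normr0 mulr_ge0 ?subr_ge0 // divr_ge0 // ltW.
have n0 : 0 < `|V (eps s) - V (eps t)| by rewrite normr_gt0 subr_eq0.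
have /andP[d0 _] := eps_lip s0 st.
have h := resolvent_dist hH hmono (hV es) (hV et).
have h1 := ip_ge hH (V (eps t)) (V (eps s) - V (eps t)).
have Vty := norm_le_of_sqr_le_ip hH (resolvent_zero hH hmono et (hV et) By).
set X := `|_ - _| in h h1 n0 *.
have h2 : eps s * X ^+ 2 <= (eps s - eps t) * (`|y| * X).
  apply: (le_trans h); rewrite -opprB mulNr -mulrN ler_wpM2l //.
  have : `|V (eps t)| * X <= `|y| * X by rewrite ler_wpM2r // ltW.
  lra.
have h3 : eps s * X <= eps s * (`|y| / (c + s) * (t - s)).
  rewrite -(ler_pM2r n0) -[leLHS]mulrA -expr2 (le_trans h2) //.
  rewrite mulrA ler_wpM2r ?(ltW n0) //.
  rewrite (_ : _ * (_ / _ * _) = eps s * (t - s) / (c + s) * `|y|).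
    by rewrite ler_wpM2r // eps_ratio.
  by field; rewrite lt0r_neq0.
by rewrite ler_pM2l in h3.
Qed.

Variable u : R -> H.
Hypothesis hu : forall T, rsol ip B eps u 0 T.

Let g t := `|u t - V (eps t)|.

Let g_right t : 0 <= t -> 0 < g t -> forall n, 0 < n -> \forall s \near t^'+,
  g s <= g t + (- (eps t * g t) + `|y| / (c + t) + n) * (s - t).
Proof.
move=> t0 gt0 n n0; have et := eps_gt0 t0.
have pd : rderiv ip (fun s => u s - V (eps t)) t (- regop B eps t (u t) - 0).
  apply: rderivB; last exact: rderiv_cst.
  by apply: (hu (t + 1)).1; rewrite t0 ltrDl ltr01.
(* This slack in the squared estimate becomes [n] after passing from [g^2] to [g]. *)
have gn : 0 < 2 * g t * n by rewrite !mulr_gt0.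
have q0 := regop_monotone hH hmono eps_lip (u t) (V (eps t)) t0 t0.
rewrite {2}/regop hV // subrr normr0 mulr0 !mul0r !subr0 in q0.
(* For [s - t < 1 / k] the bound [g t + (- eps t g t + n) (s - t)] is nonnegative, so squares can be
   compared. *)
pose k := eps t + 1; have k0 : 0 < k by rewrite addr_gt0.
near=> s; have ts : t <= s by near: s; exact: nbhs_right_ge.
have st0 : 0 <= s - t by rewrite subr_ge0.
have h1 : `|u s - V (eps t)| ^+ 2 <= g t ^+ 2 +
    (2 * ip (- regop B eps t (u t) - 0) (u t - V (eps t)) + 2 * g t * n) * (s - t).
  by near: s; exact: (rderiv_sqrnorm hH pd gn).
rewrite subr0 ipNl in h1.
have h2 : `|u s - V (eps t)| ^+ 2 <= g t ^+ 2 +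
    2 * g t * ((- (eps t * g t) + n) * (s - t)).
  apply: (le_trans h1); rewrite lerD2l [leRHS]mulrA ler_wpM2r //.
  move: q0; rewrite -/(g t); lra.
have sk : s - t < k^-1.
  by near: s; apply: nbhs_right_ltDr; rewrite invr_gt0.
have h3 : 0 <= g t + (- (eps t * g t) + n) * (s - t).
  have : g t * (eps t * (s - t)) <= g t * 1.
    rewrite ler_pM2l //; have : k * (s - t) < 1 by rewrite mulrC -ltr_pdivlMr // div1r.
    rewrite /k; lra.
  have : 0 <= n * (s - t) by rewrite mulr_ge0 // ltW.
  lra.
have h4 : `|u s - V (eps t)| <= g t + (- (eps t * g t) + n) * (s - t).
  rewrite -ler_sqr ?nnegrE // (le_trans h2) //.
  have := sqr_ge0 ((- (eps t * g t) + n) * (s - t)).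
  move: (_ * (s - t)) => X X2; rewrite sqrrD -mulr_natl; lra.
have h5 := V_lip t0 ts.
rewrite /g -(subrKA (V (eps t))) (le_trans (ler_normD _ _)) //.
move: h4 h5; rewrite /g; lra.
Unshelve. all: by end_near. Qed.

Let g_left_continuous t : 0 < t -> g x @[x --> t^'-] --> g t.
Proof.
move=> t0; apply: cvg_norm; apply: cvgB.
  by apply: (hu t).2; rewrite t0 lexx.
apply/cvgrPdist_le => e e0.
have k0 : 0 < `|y| / c + 1 by rewrite ltr_wpDl // divr_ge0 // ltW.
near=> s.
have st : s <= t by near: s; exact: nbhs_left_le.
have s0 : 0 <= s by near: s; exact: nbhs_left_ge.
have h : t - s < e / (`|y| / c + 1).
  by near: s; apply: nbhs_left_ltBl; rewrite divr_gt0.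
rewrite distrC (le_trans (V_lip s0 st)) //.
rewrite ltr_pdivlMr // in h; apply: le_trans (ltW h).
rewrite mulrC ler_wpM2l ?subr_ge0 //.
apply: (@le_trans _ _ (`|y| / c)); last by rewrite lerDl.
by rewrite ler_wpM2l // lef_pV2 ?posrE ?lerDl // ltr_pwDl.
Unshelve. all: by end_near. Qed.

Let g_right_continuous t : 0 <= t -> g x @[x --> t^'+] --> g t.
Proof.
move=> t0; apply: cvg_norm; apply: cvgB.
  apply: (rderiv_right_continuous (ip := ip)); apply: (hu (t + 1)).1.
  by rewrite t0 ltrDl ltr01.
apply/cvgrPdist_le => e e0.
have k0 : 0 < `|y| / (c + t) + 1 by rewrite ltr_wpDl // divr_ge0 // addr_ge0 // ltW.
near=> s.
have ts : t <= s by near: s; exact: nbhs_right_ge.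
have h : s - t < e / (`|y| / (c + t) + 1).
  by near: s; apply: nbhs_right_ltDr; rewrite divr_gt0.
rewrite (le_trans (V_lip t0 ts)) //.
rewrite ltr_pdivlMr // in h; apply: le_trans (ltW h).
by rewrite mulrC ler_wpM2l ?subr_ge0 // lerDl.
Unshelve. all: by end_near. Qed.

(* Once [eps >= 1 / (c + t)] and [d eps >= |y| / (c + t)], the quantity
   [(c + t) (g t - d)] cannot increase as long as it is positive. *)
Let g_small d : 0 < d -> exists T0 K : R, [/\ 0 <= T0, 0 <= K &
  forall T, T0 <= T -> (c + T) * (g T - d) <= K].
Proof.
move=> d0.
have [T1 [_ hT1]] := eps_toy (1 + `|y| / d).
pose T0 := Num.max 0 T1 + 1.
have T00 : 0 <= T0 by rewrite addr_ge0 // le_max lexx.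
pose K := Num.max 0 ((c + T0) * (g T0 - d)).
exists T0, K; split=> // [|T T0T]; first by rewrite le_max lexx.
rewrite -subr_le0.
apply: (@dini_le0 _ (fun t => (c + t) * (g t - d) - K) T0 T T0T).
- move=> t /andP[t0 _]; apply: cvgB; last exact: cvg_cst.
  apply: cvgM; first by apply: cvgD; [exact: cvg_cst | exact: cvg_at_left_filter].
  apply: cvgB; last exact: cvg_cst.
  by apply: g_left_continuous; apply: le_lt_trans t0.
- move=> t /andP[t0 _]; apply: cvgB; last exact: cvg_cst.
  apply: cvgM; first by apply: cvgD; [exact: cvg_cst | exact: cvg_at_right_filter].
  apply: cvgB; last exact: cvg_cst.
  by apply: g_right_continuous; apply: le_trans t0.
- move=> t /andP[T0t _]; rewrite subr_gt0 => Kg n n0.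
  have t0 : 0 <= t by apply: le_trans T0t.
  have ct : 0 < c + t by rewrite ltr_pwDl.
  have gd : 0 < g t - d.
    rewrite -(pmulr_rgt0 _ ct); apply: le_lt_trans Kg.
    by rewrite le_max lexx.
  have gt0 : 0 < g t by lra.
  have ct1 : 0 < c + t + 1 by lra.
  (* The slack of [g_right] gets multiplied by [c + s], at most [c + t + 1] for [s < t + 1]. *)
  have n1 : 0 < n / (c + t + 1) by rewrite divr_gt0.
  have T1t : T1 < t.
    by apply: lt_le_trans T0t; rewrite ltr_pwDr // le_max lexx orbT.
  have /= e1 := hT1 t T1t.
  pose D := - (eps t * g t) + `|y| / (c + t).
  (* This decrease compensates the term [g t - d] produced by the growth of the factor [c + t]. *)
  have hD : (c + t) * D <= - (g t - d).
    have -> : (c + t) * D = - (eps t * (c + t)) * g t + `|y|.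
      by rewrite /D; field; rewrite lt0r_neq0.
    have : (1 + `|y| / d) * g t <= eps t * (c + t) * g t by rewrite ler_wpM2r // ltW.
    have : `|y| / d * d <= `|y| / d * g t by rewrite ler_wpM2l ?divr_ge0 //; lra.
    rewrite divfK ?lt0r_neq0 //; lra.
  have D0 : D <= 0.
    by rewrite -(pmulr_rle0 _ ct); lra.
  near=> s; have ts : t <= s by near: s; exact: nbhs_right_ge.
  have s1 : s < t + 1 by near: s; apply: nbhs_right_lt; rewrite ltrDl ltr01.
  have h : g s <= g t + (D + n / (c + t + 1)) * (s - t).
    by near: s; exact: g_right.
  have cs : 0 <= c + s by lra.
  have h1 : (c + s) * g s <= (c + s) * (g t + (D + n / (c + t + 1)) * (s - t)).
    by rewrite ler_wpM2l.
  have h2 : (c + s) * (n / (c + t + 1)) <= n.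
    rewrite mulrCA ler_piMr // ?(ltW n0) // ler_pdivrMr // mul1r; lra.
  have h3 : (c + s) * D <= (c + t) * D by rewrite ler_wnM2r // lerD2l.
  have st0 : 0 <= s - t by lra.
  have h4 : ((c + s) * D + (c + s) * (n / (c + t + 1))) * (s - t) <=
      (- (g t - d) + n) * (s - t) by rewrite ler_wpM2r //; lra.
  rewrite mulrDr mulrA mulrDr in h1; rewrite mulrBr; lra.
- by rewrite subr_le0 le_max lexx orbT.
Unshelve. all: by end_near. Qed.

Lemma regularized_cvg : u t @[t --> +oo] --> y.
Proof.
apply/cvgrPdist_le => e e0.
have e4 : 0 < e / 4 by rewrite divr_gt0.
have [T0 [K [T00 K0 hK]]] := g_small e4.
have /cvgrPdist_le /(_ _ e4) /near_right_ex [r r0 hr] := Vy.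
near=> t.
have T0t : T0 <= t by near: t; apply: nbhs_pinfty_ge; exact: num_real.
have t0 : 0 <= t by apply: le_trans T0t.
have ct : 0 < c + t by rewrite ltr_pwDl.
(* Then [K <= (c + t) (e / 4)], and the bound of [g_small] gives [g t <= e / 4 + e / 4]. *)
have Kt : K / (e / 4) <= t by near: t; apply: nbhs_pinfty_ge; exact: num_real.
have et : eps t < r.
  near: t; apply: (cvgr_lt _ eps_to0) => //.
have h1 : `|y - V (eps t)| <= e / 4.
  by apply: hr; rewrite add0r et eps_gt0.
have h2 : g t <= e / 2.
  have := hK t T0t; rewrite ler_pdivrMr // in Kt.
  move=> h; have : (c + t) * (g t - e / 4) <= (c + t) * (e / 4).
    apply: (le_trans h); apply: (le_trans Kt); rewrite ler_pM2r // lerDr ltW //.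
  rewrite ler_pM2l //; lra.
rewrite -(subrKA (V (eps t))) (le_trans (ler_normD _ _)) // (distrC _ (u t)).
move: h2; rewrite /g; lra.
Unshelve. all: by end_near. Qed.

End Convergence.

(** * Weak solutions and the weight *)

Section WeakSolutions.
Variables (R : realType) (H : completeNormedModType R) (ip : {dot H for idfun}).
Hypothesis hH : norm_induced_by ip.
Variable B : H -> H.
Hypothesis hmono : monotone_op ip B.
Hypothesis hhemi : hemicontinuous ip B.
Variables (eps : R -> R) (L : R).
Hypothesis eps_ge0 : forall t, 0 <= t -> 0 <= eps t.
Hypothesis eps_lip : forall s t, 0 <= s -> s <= t -> 0 <= eps s - eps t <= L * (t - s).

Local Notation A := (regop B eps).
Local Notation rsol := (rsol ip B eps).

(* Demicontinuity makes the right derivative of [ip (u t) z] continuous, so the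
   increments of a right solution are controlled on both sides of [t]. *)
Lemma rsol_increment (u : R -> H) (t : R) (z : H) (e : R) :
  (forall T, rsol u 0 T) -> 0 <= t -> 0 < e ->
  exists2 r, 0 < r & forall a b, 0 <= a -> t - r < a -> a <= b -> b < t + r ->
    `|ip (u b - u a) z + (b - a) * ip (A t (u t)) z| <= e * (b - a).
Proof.
move=> hu t0 e0.
have [d d0 hd] := regop_demicontinuous hH hmono hhemi eps_ge0 eps_lip (u t) z t0 e0.
have /cvgrPdist_lt /(_ _ d0) /near_right_ex [r1 r10 hr1] : u x @[x --> t^'+] --> u t.
  apply: (rderiv_right_continuous (ip := ip)); apply: (hu (t + 1)).1.
  by rewrite t0 ltrDl ltr01.
have [r2 r20 hr2] : exists2 r, 0 < r &
    forall s, t - r < s < t -> 0 <= s -> `|u t - u s| < d.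
  move: t0; rewrite le_eqVlt => /predU1P[<-|t0].
    by exists 1 => // s /andP[_ s0] s0'; exfalso; lra.
  have /cvgrPdist_lt /(_ _ d0) /near_left_ex [r r0 hr] : u x @[x --> t^'-] --> u t.
    by apply: (hu t).2; rewrite t0 lexx.
  by exists r => // s hs _; exact: hr.
exists (Num.min d (Num.min r1 r2)); first by rewrite !lt_min d0 r10.
move=> a b a0 ta ab bt.
have m1 : Num.min d (Num.min r1 r2) <= d by rewrite ge_min lexx.
have m2 : Num.min d (Num.min r1 r2) <= r1 by rewrite !ge_min lexx orbT.
have m3 : Num.min d (Num.min r1 r2) <= r2 by rewrite !ge_min lexx !orbT.
have hA s : a <= s < b -> `|ip (A s (u s) - A t (u t)) z| <= e.
  move=> /andP[as_ sb]; have s0 : 0 <= s by apply: le_trans as_.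
  apply: hd => //.
    by rewrite ltr_norml; apply/andP; split; lra.
  rewrite distrC; have [st|ts|->] := ltgtP s t; last by rewrite subrr normr0.
    by apply: hr2 => //; apply/andP; split; lra.
  by apply: hr1; apply/andP; split; lra.
have ud s : a <= s < b -> rderiv ip u s (- A s (u s)).
  by move=> /andP[as_ sb]; apply: (hu b).1; rewrite sb (le_trans a0).
have ul s : a < s <= b -> u x @[x --> s^'-] --> u s.
  by move=> /andP[as_ sb]; apply: (hu b).2; rewrite sb (le_lt_trans a0).
have h1 : ip (u b - u a) z <= (- ip (A t (u t)) z + e) * (b - a).
  apply: (ip_increment_le hH ab ud ul) => s /hA.
  rewrite ler_norml (ipDl _ z) !(ipNl _ z) => /andP[h _]; lra.
have h2 : ip (u b - u a) (- z) <= (ip (A t (u t)) z + e) * (b - a).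
  apply: (ip_increment_le hH ab ud ul) => s /hA.
  rewrite ler_norml (ipDl _ z) ipNr !(ipNl _ z) => /andP[_ h]; lra.
move: h1 h2; rewrite ipNr ler_norml => h1 h2; apply/andP; split; lra.
Qed.

Lemma rsol_weak (u : R -> H) (u0 : H) : u 0 = u0 ->
  (forall T, rsol u 0 T) -> weak_global_solution ip B eps u0 u.
Proof.
move=> uE hu; split=> //.
- apply/continuous_within_itvcyP.
  have ur t : 0 <= t -> u x @[x --> t^'+] --> u t.
    move=> t0; apply: (rderiv_right_continuous (ip := ip)).
    by apply: (hu (t + 1)).1; rewrite t0 ltrDl ltr01.
  split; last exact: ur.
  move=> t; rewrite in_itv /= andbT => t0; apply/left_right_continuousP; split.
    by apply: (hu t).2; rewrite t0 lexx.
  exact/ur/ltW.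
- move=> z t t0.
  suff h : h^-1 *: (((fun s => ip (u s) z) \o shift t) (h *: 1) - ip (u t) z)
      @[h --> (0 : R)^'] --> (- ip (A t (u t)) z : R).
    split; first by apply/cvg_ex; exists (- ip (A t (u t)) z).
    exact: (cvg_lim _ h).
  apply/cvgrPdist_le => e e0.
  have [r r0 hr] := rsol_increment z hu (ltW t0) e0.
  (* The bound [t] keeps [t + h] nonnegative, where [u] solves the equation. *)
  exists (Num.min r t); first by rewrite /= lt_min r0.
  move=> h /=; rewrite sub0r normrN lt_min => /andP[hr' ht] h0.
  move: hr' ht; rewrite !ltr_norml => /andP[h1 h2] /andP[h3 h4].
  rewrite /shift /= (_ : h *: 1 + t = t + h); last by rewrite addrC /GRing.scale /= mulr1.
  have hn : 0 < `|h| by rewrite normr_gt0.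
  rewrite -(ler_pM2l hn) -normrM.
  rewrite (_ : h * _ = - (ip (u (t + h) - u t) z + h * ip (A t (u t)) z)); last first.
    rewrite ipDl ipNl /GRing.scale /= mulrBr mulrA divff // mul1r; ring.
  rewrite normrN; have [hpos|hneg] := ltP 0 h.
    rewrite (gtr0_norm hpos).
    have := hr t (t + h) (ltW t0); rewrite [t + h - t]addrAC subrr add0r.
    rewrite [h * e]mulrC; apply; lra.
  (* For negative [h] the increment is taken over [[t + h, t]]. *)
  rewrite (ler0_norm hneg).
  have := hr (t + h) t; rewrite (_ : t - (t + h) = - h); last by ring.
  rewrite [- h * e]mulrC -normrN => hh.
  rewrite (_ : - _ = ip (u t - u (t + h)) z + - h * ip (A t (u t)) z).
    apply: hh; lra.
  by rewrite !ipDl !ipNl; ring.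
- move=> z; apply/cvgrPdist_le => e e0.
  have [r r0 hr] := rsol_increment z hu (lexx 0) e0.
  apply: (ex_near_right r0) => h; rewrite !add0r => /andP[h0 hr'].
  have := hr 0 h; rewrite subr0 !add0r oppr_lt0 => /(_ (lexx 0) r0 (ltW h0) hr') hh.
  rewrite -(ler_pM2l h0) [h * e]mulrC -{1}(gtr0_norm h0) -normrM.
  rewrite -/(A 0 (u 0)).
  rewrite (_ : h * _ = - (ip (u h - u 0) z + h * ip (A 0 (u 0)) z)) ?normrN //.
  by rewrite (ipDl _ z (u h)) ipNl mulrBr mulrA divff ?lt0r_neq0 // mul1r; ring.
Qed.

(** What a weak solution does not provide directly is the strong Lipschitz bound in [rderiv]. It
    follows from the scalar mean value theorem for [(v x, z)] with [z = v s - v t], which gives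
    [|z|^2 <= M |z| (s - t)]. *)
Lemma weak_rsol (v : R -> H) (u0 : H) :
  weak_global_solution ip B eps u0 v -> forall T, rsol v 0 T.
Proof.
move=> [vc _ vd v0] T.
have /continuous_within_itvcyP [vco vcr] := vc.
have vcc t : 0 < t -> {for t, continuous v}.
  by move=> t0; apply: vco; rewrite in_itv /= andbT.
split=> t /andP[t0 tT]; last by have /left_right_continuousP[] := vcc t t0.
split=> [z e e0|].
  have : (fun h => h^-1 * (ip (v (t + h)) z - ip (v t) z)) @ 0^'+ -->
      - ip (A t (v t)) z.
    move: t0; rewrite le_eqVlt => /predU1P[<-|t0].
      by under eq_fun do rewrite add0r; exact: v0.
    have [dv dE] := vd z t t0; have : cvg _ := dv; rewrite -dE /derive => h.
    have := cvg_dnbhs_at_right h.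
    by under eq_fun do rewrite /= /shift /= /GRing.scale /= mulr1 (addrC _ t).
  move=> /cvgrPdist_le /(_ _ e0) /near_right_ex [r r0 hr].
  apply: (ex_near_right r0) => s /andP[ts st].
  have h0 : 0 < s - t by rewrite subr_gt0.
  have := hr (s - t); rewrite add0r h0 ltrBlDl st => /(_ isT) /= hh.
  move: hh.
  rewrite -(ler_pM2l h0) [_ * e]mulrC -{1}(gtr0_norm h0) -normrM.
  rewrite (addrC t) subrK -normrN.
  suff -> : - ((s - t) * (- ip (A t (v t)) z - (s - t)^-1 * (ip (v s) z - ip (v t) z))) =
    ip (v s - v t) z - (s - t) * ip (- A t (v t)) z by [].
  by rewrite ipDl !ipNl mulrBr mulrA divff ?lt0r_neq0 // mul1r; ring.
have [r [M [r0 M0 hM]]] := regop_locally_bounded hH hmono eps_ge0 eps_lip (v t).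
have vr : v x @[x --> t^'+] --> v t.
  move: t0; rewrite le_eqVlt => /predU1P[<- //|t0].
  by have /left_right_continuousP[] := vcc t t0.
have /cvgrPdist_le /(_ _ r0) /near_right_ex [d d0 hd] := vr.
exists M; apply: (ex_near_right d0) => s /andP[ts sd].
pose z := v s - v t.
have [z0|z0] := eqVneq z 0.
  by rewrite -/z z0 normr0 mulr_ge0 ?subr_ge0 // ltW.
have n0 : 0 < `|z| by rewrite normr_gt0.
have [x| |x + hx] := @MVT R (fun x => ip (v x) z) (fun x => - ip (A x (v x)) z) t s ts.
- rewrite in_itv /= => /andP[tx _]; apply: vd; exact: le_lt_trans tx.
- have vts : {within `[t, s], continuous v}.
    apply: continuous_subspaceW vc => x /=; rewrite !in_itv /= andbT => /andP[tx _].
    exact: le_trans tx.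
  by move=> x; apply: (cvg_ipl hH); [exact: (@nbhs_filter (subspace _) x) | exact: vts].
rewrite in_itv /= => /andP[tx xs].
have h1 : ip (v s) z - ip (v t) z = `|z| * `|z|.
  by rewrite -ipNl -ipDl -/z (ip_sqr hH) expr2.
rewrite h1 in hx.
have h2 : `|A x (v x)| <= M.
  apply: hM; first exact: le_trans (ltW tx).
  by rewrite distrC; apply: hd; rewrite tx (lt_trans xs).
have h3 := ip_ge hH (A x (v x)) z.
have h4 : `|A x (v x)| * `|z| <= M * `|z| by rewrite ler_wpM2r.
have h5 : - ip (A x (v x)) z * (s - t) <= M * `|z| * (s - t).
  by rewrite ler_wpM2r ?subr_ge0 ?(ltW ts) //; lra.
rewrite -/z -(ler_pM2l n0) hx; apply: (le_trans h5).
by rewrite mulrCA mulrA.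
Qed.

End WeakSolutions.

(** * Estimates for the power weight *)

Section PowerWeight.
Variables (R : realType) (c0 c1 b : R).
Hypotheses (hc0 : 0 < c0) (hc1 : 0 < c1) (hb0 : 0 < b) (hb1 : b < 1).
Variable eps : R -> R.
Hypothesis heps : forall t : R, 0 <= t -> eps t = c1 / (c0 + t) `^ b.

Lemma power_weight_gt0 (t : R) : 0 <= t -> 0 < eps t.
Proof. by move=> t0; rewrite heps // divr_gt0 // powR_gt0 // ltr_pwDl. Qed.

Lemma power_weight_noninc (s t : R) : 0 <= s -> s <= t -> eps t <= eps s.
Proof.
move=> s0 st; have t0 := le_trans s0 st; rewrite !heps //.
rewrite ler_pM2l // lef_pV2 ?posrE ?powR_gt0 ?ltr_pwDl //.
by rewrite ge0_ler_powR ?nnegrE ?lerD2l ?(ltW hb0) // addr_ge0 // ltW.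
Qed.

(* [x ^ b >= x] for [0 < x <= 1] and [b <= 1], at [x = (c0 + s) / (c0 + t)]. *)
Lemma power_weight_ratio (s t : R) : 0 <= s -> s <= t ->
  eps s - eps t <= eps s * (t - s) / (c0 + s).
Proof.
move=> s0 st; have t0 := le_trans s0 st.
have x0 : 0 < c0 + s by rewrite ltr_pwDl.
have y0 : 0 < c0 + t by rewrite ltr_pwDl.
have es := power_weight_gt0 s0.
have q0 : 0 < (c0 + s) / (c0 + t) by rewrite divr_gt0.
have q1 : (c0 + s) / (c0 + t) <= 1 by rewrite ler_pdivrMr // mul1r lerD2l.
have qb : (c0 + s) / (c0 + t) <= ((c0 + s) / (c0 + t)) `^ b.
  by apply: ger1_powR; rewrite ?q0 // ltW.
have etE : eps t = eps s * ((c0 + s) / (c0 + t)) `^ b.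
  rewrite !heps // powRM ?invr_ge0 ?(ltW x0) ?(ltW y0) //.
  rewrite -(powR_inv1 (ltW y0)) -powRrM mulN1r powRN.
  by rewrite mulrA divfK // lt0r_neq0 // powR_gt0.
have h1 : eps s * ((c0 + s) / (c0 + t)) <= eps t by rewrite etE ler_pM2l.
suff : eps s - eps s * ((c0 + s) / (c0 + t)) <= eps s * (t - s) / (c0 + s) by lra.
rewrite -{1}[eps s]mulr1 -mulrBr -mulrA ler_pM2l //.
rewrite (_ : 1 - _ = (t - s) / (c0 + t)); last by field; rewrite lt0r_neq0.
by rewrite ler_wpM2l ?subr_ge0 // lef_pV2 ?posrE // lerD2l.
Qed.

(** [eps s / (c0 + s)] is largest at [s = 0], so the relative estimate yields a uniform Lipschitz
    constant. *)
Lemma power_weight_lip (s t : R) : 0 <= s -> s <= t ->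
  0 <= eps s - eps t <= eps 0 / c0 * (t - s).
Proof.
move=> s0 st; rewrite subr_ge0 power_weight_noninc //=.
apply: (le_trans (power_weight_ratio s0 st)).
rewrite [leRHS]mulrAC -!mulrA; apply: ler_pM.
- exact/ltW/power_weight_gt0.
- by rewrite mulr_ge0 ?subr_ge0 // invr_ge0 addr_ge0 // ltW.
- exact: power_weight_noninc.
by rewrite ler_wpM2l ?subr_ge0 // lef_pV2 ?posrE ?lerDl // ltr_pwDl.
Qed.

Lemma powR_toy (p K : R) : 0 < p -> \forall t \near +oo, K <= (c0 + t) `^ p.
Proof.
move=> p0; pose K1 := Num.max K 1.
have K10 : 0 < K1 by rewrite lt_max ltr01 orbT.
near=> t; apply: (@le_trans _ _ K1); first by rewrite le_max lexx.
rewrite -[leLHS](powRr1 (ltW K10)) -(mulVf (lt0r_neq0 p0)) powRrM.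
rewrite ge0_ler_powR ?(ltW p0) ?nnegrE ?powR_ge0 //.
  by rewrite addr_ge0 ?(ltW hc0) //; near: t; apply: nbhs_pinfty_ge; exact: num_real.
apply: (@le_trans _ _ t); last by rewrite lerDr ltW.
by near: t; apply: nbhs_pinfty_ge; exact: num_real.
Unshelve. all: by end_near. Qed.

Lemma power_weight_cvg0 : eps t @[t --> +oo] --> 0.
Proof.
apply/cvgrPdist_le => e e0; near=> t.
have t0 : 0 <= t by near: t; apply: nbhs_pinfty_ge; exact: num_real.
rewrite sub0r normrN gtr0_norm ?power_weight_gt0 // heps //.
rewrite ler_pdivrMr ?powR_gt0 ?ltr_pwDl // mulrC -ler_pdivrMr //.
by near: t; exact: powR_toy.
Unshelve. all: by end_near. Qed.

(** The product is [c1 (c0 + t)^(1 - b)], with a positive exponent since [b < 1]: the weight decays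
    slowly enough to dominate the drift of order [1 / t] of the resolvent curve. *)
Lemma power_weight_mul_toy (K : R) : \forall t \near +oo, K <= eps t * (c0 + t).
Proof.
have b1 : 0 < 1 - b by rewrite subr_gt0.
near=> t.
have t0 : 0 <= t by near: t; apply: nbhs_pinfty_ge; exact: num_real.
have x0 : 0 < c0 + t by rewrite ltr_pwDl.
have -> : eps t * (c0 + t) = c1 * (c0 + t) `^ (1 - b).
  rewrite heps // powRB ?(gt_eqF x0) ?implybT // powRr1 ?(ltW x0) //.
  by rewrite mulrAC mulrA.
rewrite mulrC -ler_pdivrMr //.
by near: t; exact: powR_toy.
Unshelve. all: by end_near. Qed.

End PowerWeight.

Theorem theorem1 (R : realType) (H : completeNormedModType R)
    (ip : {dot H for idfun}) (hH : norm_induced_by ip)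
    (B : H -> H) (hmono : monotone_op ip B) (hhemi : hemicontinuous ip B)
    (hsol : exists z : H, B z = 0)
    (c0 c1 b : R) (hc0 : 0 < c0) (hc1 : 0 < c1) (hb0 : 0 < b) (hb1 : b < 1)
    (eps : R -> R)
    (heps : forall t : R, 0 <= t -> eps t = c1 / (c0 + t) `^ b)
    (u0 : H) :
  exists u : R -> H,
    [/\ weak_global_solution ip B eps u0 u,
        (forall v : R -> H, weak_global_solution ip B eps u0 v ->
           forall t : R, 0 <= t -> v t = u t),
        cvg (u t @[t --> +oo]),
        B (lim (u t @[t --> +oo])) = 0
      & exists y : H, unique (minimal_norm_zero B) y /\
                      lim (u t @[t --> +oo]) = y].
Proof.
have eps_gt0 := power_weight_gt0 hc0 hc1 heps.
have eps_ge0 t : 0 <= t -> 0 <= eps t by move=> /eps_gt0 /ltW.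
have eps_lip := power_weight_lip hc0 hc1 hb0 hb1 heps.
have [u [uE hu]] := global_existence hH hmono hhemi eps_ge0 eps_lip hsol u0.
have [V [y [hV Vy By ymin]]] := resolvent_limit hH hmono hhemi hsol.
have ucvg : u t @[t --> +oo] --> y.
  apply: (regularized_cvg hH hmono hc0 eps_gt0 eps_lip _ _ _ hV Vy By hu).
  - exact: (power_weight_ratio hc0 hc1 hb1 heps).
  - exact: (power_weight_cvg0 hc0 hc1 hb0 heps).
  - exact: (power_weight_mul_toy hc0 hc1 hb1 heps).
have ulim : lim (u t @[t --> +oo]) = y by apply: cvg_lim.
exists u; split.
- exact: (rsol_weak hH hmono hhemi eps_ge0 eps_lip uE hu).
- move=> v hv t t0; have hv' := weak_rsol hH hmono eps_ge0 eps_lip hv.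
  apply: (rsol_unique hH hmono eps_ge0 eps_lip (lexx 0) (hv' t) (hu t)).
    by have [_ -> _ _] := hv.
  by rewrite t0 lexx.
- by apply/cvg_ex; exists y.
- by rewrite ulim.
exists y; split=> //; split.
  by split=> // z /ymin; exact: norm_le_of_sqr_le_ip.
(* By the variational inequality [|z - y|^2 <= |z|^2 - |y|^2], which is nonpositive when [z] also
   has minimal norm. *)
move=> z [Bz zmin]; apply/esym/eqP.
rewrite -subr_eq0 -normr_eq0 -sqrf_eq0 eq_le sqr_ge0 andbT.
have zy : `|z| ^+ 2 <= `|y| ^+ 2 by rewrite ler_sqr ?nnegrE // zmin.
rewrite (sqrnormB hH) (ipC ip z y); have := ymin z Bz; lra.
Qed.
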